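(* Let $\mathcal{L}$ be any Lipschitz continuous signature. Then $\mathrm{Iso}(\mathbb{U}_{\mathcal{L}})$ has the strong Lévy property.
   Context: All topological spaces are assumed Hausdorff. A topological group $G$ has the strong Lévy property if there is an increasing sequence $(K_i)_{i\in\mathbb{N}}$ of finite subgroups of $G$, with normalized counting measures $\mu_i$ on $K_i$ (regarded as measures on $G$), such that (i) $\bigcup_i K_i$ is dense in $G$, and (ii) for each open neighborhood $V$ of the identity and each sequence of sets $A_i\subseteq K_i$ with $\liminf_i\mu_i(A_i)>0$, one has $\lim_i\mu_i(VA_i)=1$. A modulus of continuity is a nondecreasing function $u\colon(0,\infty)\to(0,\infty]$ with $\lim_{x\to0}u(x)=0$ (we put $u(0)=0$). A map $f$ between metric spaces is uniformly continuous with respect to $u$ if $d_2(f(x),f(y))\le u(d_1(x,y))$ for all $x,y$. A continuous signature $\mathcal{L}$ here consists of a distance symbol $d$ and finitely many relation symbols $R$, each with an arity $n\ge1$ and, for each coordinate $1\le i\le n$, a modulus of continuity $u_{R,i}$ (there are no function symbols). An $\mathcal{L}$-pre-structure is a metric space $(A,d_A)$ with, for each $n$-ary $R\in\mathcal{L}$, a function $R^A\colon A^n\to[0,1]$ that is uniformly continuous in its $i$-th coordinate with respect to $u_{R,i}$ (the other coordinates being fixed), for each $i$; it is an $\mathcal{L}$-structure if $(A,d_A)$ is complete. Embeddings and isomorphisms preserve the metric and all relations. Let $I_{R,i}=\{r\in[0,+\infty] : u_{R,i}(r)<1\}$. $\mathcal{L}$ is semiproper if for every $n$-ary $R$ and $1\le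 i\le n$, $I_{R,i}$ is bounded and $u_{R,i}(r_1+r_2)\ge u_{R,i}(r_1)+u_{R,i}(r_2)$ for all $r_1,r_2\in I_{R,i}$, and for every $n$-ary $R$ with $n\ge2$ and $1\le i\le n$ there is $K_{R,i}>0$ with $u_{R,i}(r)=K_{R,i}r$ for all $r\in I_{R,i}$. $\mathcal{L}$ is proper if it is semiproper and each $u_{R,i}$ is upper semicontinuous on $I_{R,i}$. $\mathcal{L}$ is Lipschitz if it is proper and for each unary $R$ there is $K_{R,1}>0$ with $u_{R,1}(r)=K_{R,1}r$ for all $r\in I_{R,1}$. An $\mathcal{L}$-pre-structure $\mathcal{U}$ is Urysohn if for every finite $\mathcal{L}$-structure $\mathcal{M}$, every one-point extension $\mathcal{N}$ of $\mathcal{M}$ (i.e. $\mathcal{M}$ is a substructure of $\mathcal{N}$ and $N\setminus M$ is a singleton) and every isomorphic embedding $\varphi$ of $\mathcal{M}$ into $\mathcal{U}$, there is an isomorphic embedding $\psi$ of $\mathcal{N}$ into $\mathcal{U}$ with $\psi\restriction M=\varphi$. For proper $\mathcal{L}$ (hence for Lipschitz $\mathcal{L}$) it is known that there is a separable Urysohn $\mathcal{L}$-structure, unique up to isomorphism, denoted $\mathbb{U}_{\mathcal{L}}$. $\mathrm{Iso}(\mathbb{U}_{\mathcal{L}})$ is the group of all automorphisms of the $\mathcal{L}$-structure $\mathbb{U}_{\mathcal{L}}$ with the pointwise convergence topology, where $\mathbb{U}_{\mathcal{L}}$ carries its metric topology. *)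

(* Defs.v *)
From HB Require Import structures.
From mathcomp Require Import all_boot all_order all_algebra finmap.
From mathcomp Require Import all_classical all_reals all_analysis.

Set Implicit Arguments.
Unset Strict Implicit.
Unset Printing Implicit Defensive.

Import Order.TTheory GRing.Theory Num.Theory.
Import numFieldNormedType.Exports.
Import metricType_numDomainType.

Local Open Scope classical_set_scope.
Local Open Scope ring_scope.

HB.mixin Record isTopGroup G of Topological G & Group G := {
  topgroup_mul_continuous : continuous (fun x : G * G => (x.1 * x.2)%g);
  topgroup_inv_continuous : continuous (fun x : G => (x^-1)%g);
  topgroup_hausdorff : hausdorff_space G
}.

#[short(type="topGroupType")]
HB.structure Definition TopGroup := {G of Topological G & Group G & isTopGroup G}.

Section strong_levy.
Variables (R : realType) (G : topGroupType).
Implicit Types K A : set G.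

Definition finite_subgroup K := finite_set K /\ group_closed [pred x in K].

(* The normalized counting measure of a finite set [K], viewed on all of [G]:
   only the part of [A] inside [K] is counted. *)
Definition unif_prob K A : R :=
  #|` fset_set (A `&` K)|%:R / #|` fset_set K|%:R.

Definition strong_levy := exists K : nat -> set G,
  [/\ forall i, finite_subgroup (K i),
      forall i, K i `<=` K i.+1,
      dense (\bigcup_i K i)
    & forall (V : set G) (A : nat -> set G), open V -> V 1%g ->
        (forall i, A i `<=` K i) ->
        (0 < limn_einf (fun i => (unif_prob (K i) (A i))%:E))%E ->
        unif_prob (K i) [set (v * a)%g | v in V & a in A i]
          @[i --> \oo] --> (1 : R)].

End strong_levy.

Section signatures.
Variable R : realType.
Implicit Type u : R -> \bar R.

(* A modulus lives on [0, +oo[; its values at negative reals are irrelevant. *)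
Definition is_modulus u :=
  [/\ u 0 = 0%E,
      forall r, 0 < r -> (0 < u r)%E,
      forall r s, 0 < r -> r <= s -> (u r <= u s)%E
    & u r @[r --> 0^'+] --> 0%E].

Record signature := Signature {
  rel_symb : finType;
  arity : rel_symb -> nat;
  arity_gt0 : forall s, (0 < arity s)%N;
  rel_mod : forall s, 'I_(arity s) -> R -> \bar R;
  rel_modP : forall s i, is_modulus (@rel_mod s i)
}.

(* The interval I_{R,i} of a modulus. Moduli are not defined at +oo; their
   monotone extension excludes +oo from I_{R,i} as soon as I_{R,i} is bounded,
   so only finite [r] are considered. *)
Definition below1 u : set R := [set r | 0 <= r /\ (u r < 1)%E].

Definition superadditive_below1 u := forall r1 r2, below1 u r1 -> below1 u r2 ->
  (u r1 + u r2 <= u (r1 + r2)%R)%E.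

Definition linear_below1 u :=
  exists2 K : R, 0 < K & forall r, below1 u r -> u r = (K * r)%:E.

Definition upper_semicontinuous_on (D : set R) u := forall r, D r ->
  forall a : R, (u r < a%:E)%E -> \forall s \near within D (nbhs r), (u s < a%:E)%E.

Definition semiproper (L : signature) :=
  (forall s (i : 'I_(arity s)),
     bounded_set (below1 (@rel_mod L s i)) /\
     superadditive_below1 (@rel_mod L s i)) /\
  (forall s (i : 'I_(arity s)),
     (2 <= arity s)%N -> linear_below1 (@rel_mod L s i)).

Definition proper_sig (L : signature) := semiproper L /\
  forall s (i : 'I_(arity s)),
    upper_semicontinuous_on (below1 (@rel_mod L s i)) (@rel_mod L s i).

Definition lipschitz_sig (L : signature) := proper_sig L /\
  forall s (i : 'I_(arity s)),
    arity s = 1%N -> linear_below1 (@rel_mod L s i).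

End signatures.

Section structures.
Variables (R : realType) (L : signature R).

Record prestructure := Prestructure {
  carrier :> metricType R;
  interp : forall s : rel_symb L, ('I_(arity s) -> carrier) -> R;
  interp_itv : forall s (a : 'I_(arity s) -> carrier), 0 <= interp a <= 1;
  interp_ucont : forall s (i : 'I_(arity s)) (a b : 'I_(arity s) -> carrier),
    (forall j, j != i -> a j = b j) ->
    (`|interp a - interp b|%:E <= rel_mod i (mdist (a i) (b i)))%E
}.

(* Completeness is spelled out because the library's complete spaces are
   pointed, whereas a structure may be empty. *)
Record structure := Structure {
  struct_pre :> prestructure;
  struct_complete : forall F : set_system struct_pre,
    ProperFilter F -> cauchy F -> exists x : struct_pre, F --> x
}.

Definition embedding (A B : prestructure) (f : A -> B) :=
  (forall x y, mdist (f x) (f y) = mdist x y) /\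
  (forall s (a : 'I_(arity s) -> A), interp (f \o a) = interp a).

(* The inclusion of the substructure [M] into [N] is represented by the
   embedding [e]. *)
Definition one_point_extension (M N : prestructure) (e : M -> N) :=
  embedding e /\ exists p, ~` range e = [set p].

Definition urysohn (U : prestructure) :=
  forall (M N : structure) (e : M -> N) (phi : M -> U),
    finite_set [set: M] -> one_point_extension e -> embedding phi ->
    exists2 psi : N -> U, embedding psi & psi \o e = phi.

Definition separable (T : topologicalType) :=
  exists2 D : set T, countable D & dense D.

Definition automorphism (U : prestructure) (f : U -> U) :=
  bijective f /\ embedding f.

Record Iso (U : prestructure) := MkIso {
  iso_fun :> U -> U;
  iso_automorphism : automorphism iso_fun
}.

End structures.

Section Iso_group.
Variables (R : realType) (L : signature R) (U : prestructure L).
Implicit Types f g h : Iso U.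

Lemma iso_ext f g : f =1 g -> f = g.
Proof.
case: f g => [f hf] [g hg] /= /funext fg; subst g.
by congr MkIso; exact: Prop_irrelevance.
Qed.

Lemma id_automorphism : automorphism (idfun : U -> U).
Proof. by split; [exists idfun|split]. Qed.

Lemma comp_automorphism f g : automorphism (f \o g).
Proof.
case: (iso_automorphism f) (iso_automorphism g) => bf [df rf] [bg [dg rg]].
split; first exact: bij_comp.
split=> [x y|s a]; first by rewrite /= df dg.
by rewrite -compA rf rg.
Qed.

Lemma inv_ex f : exists g : Iso U, cancel f g /\ cancel g f.
Proof.
case: (iso_automorphism f) => -[g fK gK] [df rf].
suff hg : automorphism g by exists (MkIso hg).
split; first by exists f.
split=> [x y|s a]; first by rewrite -df !gK.
by rewrite -rf; congr interp; apply/funext => i /=; rewrite gK.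
Qed.

Definition iso_one : Iso U := MkIso id_automorphism.
Definition iso_mul f g : Iso U := MkIso (comp_automorphism f g).
Definition iso_inv f : Iso U := projT1 (cid (inv_ex f)).

Lemma iso_funK f : cancel f (iso_inv f).
Proof. by case: (projT2 (cid (inv_ex f))). Qed.

Lemma iso_invK f : cancel (iso_inv f) f.
Proof. by case: (projT2 (cid (inv_ex f))). Qed.

HB.instance Definition _ := gen_eqMixin (Iso U).
HB.instance Definition _ := gen_choiceMixin (Iso U).

Fact iso_mulA : associative iso_mul.
Proof. by move=> f g h; exact: iso_ext. Qed.
Fact iso_mul1 : left_id iso_one iso_mul.
Proof. by move=> f; exact: iso_ext. Qed.
Fact iso_mulr1 : right_id iso_one iso_mul.
Proof. by move=> f; exact: iso_ext. Qed.
Fact iso_mulV : left_inverse iso_one iso_inv iso_mul.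
Proof. by move=> f; apply: iso_ext => x; exact: iso_funK. Qed.
Fact iso_mulrV : right_inverse iso_one iso_inv iso_mul.
Proof. by move=> f; apply: iso_ext => x; exact: iso_invK. Qed.

HB.instance Definition _ := isGroup.Build (Iso U)
  iso_mulA iso_mul1 iso_mulr1 iso_mulV iso_mulrV.

HB.instance Definition _ := Topological.copy (Iso U)
  (initial_topology (@iso_fun R L U : Iso U -> {ptws U -> U})).

Lemma iso_cvgP (F : set_system (Iso U)) (FF : Filter F) f :
  F --> f <-> forall x, (fun g : Iso U => g x) @ F --> f x.
Proof.
have sub : F --> f <-> {ptws, (@iso_fun R L U) @ F --> (f : U -> U)}.
  split=> [Ff|Ff A].
    apply: cvg_trans (cvg_app _ Ff) _.
    exact: (@initial_continuous _ {ptws U -> U} (@iso_fun R L U) f).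
  rewrite nbhsE => -[B [[C Copen <-] Cf] BA].
  by apply: filterS BA _; apply: Ff; exact: open_nbhs_nbhs.
by rewrite sub pointwise_cvgP.
Qed.

Lemma iso_eval_continuous x : continuous (fun f : Iso U => f x).
Proof. by move=> f; exact: ((iso_cvgP (nbhs_filter f) f).1 cvg_id x). Qed.

Fact iso_mul_continuous :
  continuous (fun fg : Iso U * Iso U => (fg.1 * fg.2)%g).
Proof.
move=> [f g]; apply/iso_cvgP => x.
suff : (fun h : Iso U * Iso U => h.1 (h.2 x)) @ (f, g) --> f (g x) by [].
apply/cvgrPdist_lt => e e0.
have e20 : 0 < e / 2 by rewrite divr_gt0.
near=> h => /=.
have [dh _] := (iso_automorphism h.1).2.
rewrite (le_lt_trans (metric_triangle _ (h.1 (g x)) _))//.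
rewrite [ltRHS]splitr ltrD//.
  near: h.
  have evf : (fun h : Iso U * Iso U => h.1 (g x)) @ (f, g) --> f (g x).
    apply: (@cvg_comp _ _ _ fst (fun h : Iso U => h (g x)) _ (nbhs f)).
      exact: cvg_fst.
    exact: iso_eval_continuous.
  exact: cvgr_dist_lt evf _ e20.
rewrite dh; near: h.
have evg : (fun h : Iso U * Iso U => h.2 x) @ (f, g) --> g x.
  apply: (@cvg_comp _ _ _ snd (fun h : Iso U => h x) _ (nbhs g)).
    exact: cvg_snd.
  exact: iso_eval_continuous.
exact: cvgr_dist_lt evg _ e20.
Unshelve. all: by end_near. Qed.

Fact iso_inv_continuous : continuous (fun f : Iso U => (f^-1)%g).
Proof.
suff evV (f : Iso U) (x : U) :
    (fun h : Iso U => iso_inv h x) @ nbhs f --> iso_inv f x.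
  move=> f; apply: (iso_cvgP _ _).2; first exact: fmap_filter (nbhs_filter f).
  by move=> x; exact: evV.
apply/cvgrPdist_lt => e e0.
near=> h.
have [dh _] := (iso_automorphism h).2.
rewrite -dh (iso_invK h) -[X in mdist _ X](iso_invK f) metric_sym.
near: h; exact: cvgr_dist_lt (@iso_eval_continuous _ f) _ e0.
Unshelve. all: by end_near. Qed.

Fact iso_hausdorff : hausdorff_space (Iso U).
Proof.
move=> f g fg; apply: iso_ext => x; apply: (@metric_hausdorff R U) => A B fA gB.
have [h [hA hB]] := fg _ _ (iso_eval_continuous fA) (iso_eval_continuous gB).
by exists (h x).
Qed.

HB.instance Definition _ := isTopGroup.Build (Iso U)
  iso_mul_continuous iso_inv_continuous iso_hausdorff.

End Iso_group.

(* Main.v *)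
(**
  The group [Iso U] is the closure of an increasing union of finite groups built
  one at a time.  Given a finite group [G] acting on [U], an automorphism
  [gamma] and a finite set [Y] stable under [G], the next group is a power
  [H ^ m], acting on a finite orbit [H ^ m * Y] which extends [Y] together with
  the action of [G] (mapped diagonally), in which some element is close to
  [gamma] on a prescribed set, and such that
  [d (g y, h y) <= c * hamming g h / m].

  [H] is the symmetric group of a finite ball [B] around [1] in the group
  generated by [G] and [gamma].  Sending [y] to the family [(w y)_(w in B)]
  embeds [Y] in a space on which [H] acts by permuting coordinates, right
  multiplication by [gamma] being completed arbitrarily at the boundary of the
  ball; putting the coordinates in a cone over [U], shrunk to a point at the
  boundary, makes this completion harmless.  The power is equipped with the Ky
  Fan distance
    [min_S (max_(i notin S) d (x_i, y_i) + c * #|S| / m)]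
  and the relations with the analogous functional for the constant [1]; it is
  here, and for the cone, that linear moduli are needed.  The Urysohn property
  places the resulting finite structure in [U] over [Y], and the action of
  [H ^ m] is then extended to [U] by adding the points of a dense sequence:
  translates of a new point are first chosen arbitrarily, and distances and
  relations are replaced by their suprema over the group.

  As the variance of a function on [H ^ m] that is 1-Lipschitz for the Hamming
  distance is at most [m], Chebyshev's inequality gives the concentration of
  measure for large [m].
*)

Require Import Defs.
From HB Require Import structures.
From mathcomp Require Import all_boot all_order all_algebra all_fingroup finmap.
From mathcomp Require Import all_classical all_reals all_analysis.
From mathcomp Require Import ring lra.

Set Implicit Arguments.
Unset Strict Implicit.
Unset Printing Implicit Defensive.

Import Order.TTheory GRing.Theory Num.Theory.
Import numFieldNormedType.Exports.

Local Open Scope classical_set_scope.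
Local Open Scope ring_scope.

(** * Pseudo-structures *)

Section pseudostructures.
Variables (R : realType) (L : signature R).

(** Distinct points may be at distance 0, so pullbacks, suprema and Ky Fan powers can be formed
    without taking quotients; points are identified only when a finite structure is realized in
    [U]. *)
Record pstruct (T : Type) := PStruct {
  pd : T -> T -> R;
  pr : forall s : rel_symb L, ('I_(arity s) -> T) -> R;
  pdxx : forall x, pd x x = 0;
  pd_sym : forall x y, pd x y = pd y x;
  pd_tri : forall y x z, pd x z <= pd x y + pd y z;
  pr_itv : forall s (a : 'I_(arity s) -> T), 0 <= pr a <= 1;
  pr_ucont : forall s (i : 'I_(arity s)) (a b : 'I_(arity s) -> T),
    (forall j, j != i -> a j = b j) ->
    (`|pr a - pr b|%:E <= rel_mod i (pd (a i) (b i)))%E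
}.

Lemma pd_ge0 T (P : pstruct T) x y : 0 <= pd P x y.
Proof. by have := pd_tri P y x x; rewrite pdxx (pd_sym P y x); lra. Qed.

Lemma pd0_eq T (P : pstruct T) x y z : pd P x y = 0 -> pd P x z = pd P y z.
Proof.
move=> xy; have := pd_tri P y x z; have := pd_tri P x y z.
by rewrite (pd_sym P y x) xy; lra.
Qed.

Lemma pd0_eq2 T (P : pstruct T) x x' y y' :
  pd P x x' = 0 -> pd P y y' = 0 -> pd P x y = pd P x' y'.
Proof.
by move=> xx yy; rewrite (pd0_eq y xx) pd_sym (pd0_eq x' yy) pd_sym.
Qed.

Lemma mod_at0 (s : rel_symb L) (i : 'I_(arity s)) : rel_mod i 0 = 0%E.
Proof. by case: (rel_modP i). Qed.

Lemma mod_mono (s : rel_symb L) (i : 'I_(arity s)) x y :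
  0 <= x -> x <= y -> (rel_mod i x <= rel_mod i y)%E.
Proof.
case: (rel_modP i) => m0 mp mm _; rewrite le_eqVlt => /predU1P[<-|x0 xy].
  rewrite le_eqVlt => /predU1P[<-//|y0]; rewrite m0; exact/ltW/mp.
exact: mm.
Qed.

Lemma mod_ge0 (s : rel_symb L) (i : 'I_(arity s)) x :
  0 <= x -> (0 <= rel_mod i x)%E.
Proof. by move=> x0; rewrite -(mod_at0 i); exact: mod_mono. Qed.

(** The coordinates of [a] are replaced by those of [b] one at a time; each replacement costs the
    modulus at 0, which is 0. *)
Lemma pr_pd0 T (P : pstruct T) s (a b : 'I_(arity s) -> T) :
  (forall i, pd P (a i) (b i) = 0) -> pr P a = pr P b.
Proof.
move=> ab; pose h k (i : 'I_(arity s)) := if (i < k)%N then b i else a i.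
suff H k : (k <= arity s)%N -> pr P (h k) = pr P a.
  rewrite -(H (arity s))//; congr pr; apply/funext => i.
  by rewrite /h ltn_ord.
elim: k => [_|k IH kn]; first by congr pr; apply/funext => i.
rewrite -(IH (ltnW kn)); apply/eqP; rewrite -subr_eq0 -normr_le0 -lee_fin.
have := @pr_ucont _ P s (Ordinal kn) (h k.+1) (h k) _.
rewrite /h /= ltnSn ltnn pd_sym ab mod_at0; apply => j jk.
rewrite ltnS leq_eqVlt; case: eqP => //= jk'; case/eqP: jk; exact: val_inj.
Qed.

Program Definition pull T' T (f : T' -> T) (P : pstruct T) : pstruct T' :=
  @PStruct T' (fun x y => pd P (f x) (f y)) (fun s a => pr P (f \o a))
    _ _ _ _ _.
Next Obligation. by move=> *; exact: pdxx. Qed.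
Next Obligation. by move=> *; exact: pd_sym. Qed.
Next Obligation. by move=> *; exact: pd_tri. Qed.
Next Obligation. by move=> *; exact: pr_itv. Qed.
Next Obligation.
by move=> T' T f P s i a b ab; apply: pr_ucont => j /ab /= ->.
Qed.

Program Definition of_pre (U : prestructure L) : pstruct U :=
  @PStruct U (fun x y => mdist x y) (fun s a => interp a) _ _ _ _ _.
Next Obligation. by move=> *; exact: mdistxx. Qed.
Next Obligation. by move=> *; exact: metric_sym. Qed.
Next Obligation. by move=> *; exact: metric_triangle. Qed.
Next Obligation. by move=> *; exact: interp_itv. Qed.
Next Obligation. by move=> *; exact: interp_ucont. Qed.

Lemma bigmax_ge0 (I : finType) (p : pred I) (f : I -> R) :
  0 <= \big[Num.max/0]_(i | p i) f i.
Proof. exact: bigmax_ge_id. Qed.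

Lemma bigmax_attain (I : finType) (p : pred I) (f : I -> R) :
  \big[Num.max/0]_(i | p i) f i = 0 \/
  exists2 i, p i & \big[Num.max/0]_(i | p i) f i = f i.
Proof.
elim/big_rec: _ => [|i x pi H]; first by left.
by rewrite /Num.max; case: ifP => _; [exact: H|right; exists i].
Qed.

(** When [f] is indexed by a group and a translation of [T'] permutes the maps [f i], the supremum
    is invariant under this translation. The base value 0 of the maxima is harmless, all terms being
    nonnegative. *)
Program Definition psup T' T (I : finType) (f : I -> T' -> T) (P : pstruct T)
    : pstruct T' :=
  @PStruct T' (fun x y => \big[Num.max/0]_i pd P (f i x) (f i y))
    (fun s a => \big[Num.max/0]_i pr P (f i \o a)) _ _ _ _ _.
Next Obligation.
move=> T' T I f P x /=; apply/eqP; rewrite eq_le bigmax_ge0 andbT.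
by apply: bigmax_le => // i _; rewrite pdxx.
Qed.
Next Obligation.
by move=> T' T I f P x y; apply: eq_bigr => i _; rewrite pd_sym.
Qed.
Next Obligation.
move=> T' T I f P y x z; apply: bigmax_le => [|i _].
  by rewrite addr_ge0// bigmax_ge0.
by apply: le_trans (pd_tri P (f i y) _ _) _; apply: lerD; apply: le_bigmax.
Qed.
Next Obligation.
move=> T' T I f P s a; rewrite bigmax_ge0/=; apply: bigmax_le => // i _.
by case/andP: (pr_itv P (f i \o a)).
Qed.
Next Obligation.
move=> T' T I f P s k a b ab.
wlog W : a b ab / \big[Num.max/0]_i pr P (f i \o b) <=
                  \big[Num.max/0]_i pr P (f i \o a).
  move=> W; case: (leP (\big[Num.max/0]_i pr P (f i \o b))
      (\big[Num.max/0]_i pr P (f i \o a))) => [|/ltW] le; first exact: W.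
  rewrite distrC; have -> : \big[Num.max/0]_i pd P (f i (a k)) (f i (b k)) =
      \big[Num.max/0]_i pd P (f i (b k)) (f i (a k)).
    by apply: eq_bigr => i _; rewrite pd_sym.
  by apply: W => // j /ab.
rewrite ger0_norm ?subr_ge0//.
(* The two maxima are compared at an index where the larger one is attained. *)
have [H|[i H]] : \big[Num.max/0]_i pr P (f i \o a) = 0 \/
    exists i, \big[Num.max/0]_i pr P (f i \o a) = pr P (f i \o a).
  by have [H|[i _ H]] := bigmax_attain xpredT (fun i => pr P (f i \o a));
    [left|right; exists i].
- have -> : \big[Num.max/0]_i pr P (f i \o b) = 0.
    by apply/eqP; rewrite eq_le bigmax_ge0 andbT; move: W; rewrite H.
  by rewrite H subrr mod_ge0// bigmax_ge0.
rewrite H; apply: le_trans (_ : `|pr P (f i \o a) - pr P (f i \o b)|%:E <= _)%E.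
  rewrite lee_fin; apply: le_trans (ler_norm _) ; rewrite lerD2l lerN2.
  by rewrite (le_bigmax _ (fun i => pr P (f i \o b))).
apply: le_trans (pr_ucont _ _) _ => /=; first by move=> j /ab /= ->.
apply: mod_mono; first exact: pd_ge0.
by rewrite (le_bigmax _ (fun i => pd P (f i (a k)) (f i (b k)))).
Qed.

End pseudostructures.

(** * Ky Fan powers *)

Section ky_fan.
Variables (R : realType) (I : finType) (I0 : (0 < #|I|)%N).
Implicit Types (c : R) (f g : I -> R) (S : {set I}).

Definition kfv c f S : R :=
  \big[Num.max/0]_(i | i \notin S) f i + c * (#|S|%:R / #|I|%:R).

Definition kf c f : R :=
  kfv c f [arg min_(S < finset.set0) kfv c f S]%O.

Lemma kf_le c f S : kf c f <= kfv c f S.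
Proof. by rewrite /kf; case: arg_minP => // S' _; apply. Qed.

Lemma kf_ex c f : exists S, kf c f = kfv c f S.
Proof. by eexists. Qed.

Lemma kfv_set0 c f : kfv c f finset.set0 = \big[Num.max/0]_i f i.
Proof.
rewrite /kfv cards0 mul0r mulr0 addr0.
by apply: eq_bigl => i; rewrite inE.
Qed.

Lemma card_ratio_ge0 S : 0 <= #|S|%:R / #|I|%:R :> R.
Proof. by rewrite divr_ge0. Qed.

Lemma card_ratioU S S' : #|(S :|: S')%SET|%:R / #|I|%:R <=
  #|S|%:R / #|I|%:R + #|S'|%:R / #|I|%:R :> R.
Proof.
rewrite -mulrDl ler_wpM2r ?invr_ge0// -natrD ler_nat.
exact: leq_card_setU.
Qed.

Lemma kf_ge0 c f : 0 <= c -> 0 <= kf c f.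
Proof.
move=> c0; have [S ->] := kf_ex c f.
by rewrite addr_ge0 ?mulr_ge0 ?card_ratio_ge0// bigmax_ge_id.
Qed.

Lemma eq_kf c f g : f =1 g -> kf c f = kf c g.
Proof. by move=> /funext ->. Qed.

(** Discarding every coordinate costs [c], and discarding fewer leaves the value [v]. Hence the
    diagonal is isometric as soon as [c] bounds the distances involved. *)
Lemma kf_cst c (v : R) : 0 <= v <= c -> kf c (fun=> v) = v.
Proof.
move=> /andP[v0 vc]; apply/eqP; rewrite eq_le; apply/andP; split.
  apply: le_trans (kf_le _ _ finset.set0) _; rewrite kfv_set0.
  by apply: bigmax_le.
have [S ->] := kf_ex c (fun=> v); rewrite /kfv.
have [H|[i iS ->]] := bigmax_attain (fun i => i \notin S) (fun=> v).
  have [SI|/subsetPn[i _ iS]] := boolP ([set: I]%SET \subset S).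
    have -> : #|S| = #|I|.
      by apply/eqP; rewrite eqn_leq max_card/= -cardsT subset_leq_card.
    by rewrite divff ?pnatr_eq0 -?lt0n// mulr1 H add0r.
  rewrite -[leLHS]addr0 lerD ?mulr_ge0 ?card_ratio_ge0//; last lra.
  exact: (@le_bigmax_cond _ _ _ 0 i (fun i => i \notin S) (fun=> v) iS).
by rewrite lerDl mulr_ge0 ?card_ratio_ge0//; lra.
Qed.

(** The union of the sets discarded for [f] and [g] is discarded for [h]. *)
Lemma kf_tri c f g h : 0 <= c -> (forall i, h i <= f i + g i) ->
  kf c h <= kf c f + kf c g.
Proof.
move=> c0 hfg; have [S ->] := kf_ex c f; have [S' ->] := kf_ex c g.
apply: le_trans (kf_le _ _ (S :|: S')%SET) _; rewrite /kfv addrACA -mulrDr.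
apply: lerD; last by rewrite ler_wpM2l// card_ratioU.
apply: bigmax_le => [|i]; first by rewrite addr_ge0// bigmax_ge_id.
rewrite inE negb_or => /andP[iS iS'].
by apply: le_trans (hfg i) _; apply: lerD; apply: le_bigmax_cond.
Qed.

Lemma kf_itv c f : 0 <= c -> (forall i, 0 <= f i <= 1) -> 0 <= kf c f <= 1.
Proof.
move=> c0 f01; rewrite kf_ge0//=; apply: le_trans (kf_le _ _ finset.set0) _.
by rewrite kfv_set0; apply: bigmax_le => // i _; case/andP: (f01 i).
Qed.

End ky_fan.

(** * Linear moduli and Ky Fan powers of pseudo-structures *)

Section linear_moduli.
Variables (R : realType) (L : signature R).
Hypothesis Llin : forall (s : rel_symb L) (i : 'I_(arity s)),
  linear_below1 (rel_mod i).

(* [c] dominates the inverse of every Lipschitz constant. *)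
Definition large (c : R) := 0 < c /\
  forall (s : rel_symb L) (i : 'I_(arity s)) (r : R), 0 <= r ->
    (rel_mod i r < 1)%E -> ((r / c)%:E <= rel_mod i r)%E.

(** In the first case a modulus condition is vacuous, relations having values in [0, 1]; in the
    second the modulus is linear up to [d], with a slope that [c] compensates. *)
Lemma mod_below1 (s : rel_symb L) (i : 'I_(arity s)) (c d : R) : large c -> 0 <= d ->
  (1 <= rel_mod i d)%E \/ exists K : R, [/\ 1 <= K * c, rel_mod i d = (K * d)%:E
    & forall r : R, 0 <= r -> r <= d -> rel_mod i r = (K * r)%:E].
Proof.
move=> [c0 lc] d0; have [|d1] := leP 1%E (rel_mod i d); [by left|right].
move: d0; rewrite le_eqVlt => /predU1P[d0|d0].
  (* At distance 0 [lc] gives no bound on a Lipschitz constant, but any slope fits, in particular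
     this one. *)
  exists c^-1; rewrite mulVf ?gt_eqF//; split=> [//||r r0 rd].
    by rewrite -d0 mulr0 mod_at0.
  have -> : r = 0 by apply/le_anti; rewrite r0 d0 rd.
  by rewrite mulr0 mod_at0.
have [K K0 HK] := Llin i; exists K.
have HK' r : 0 <= r -> r <= d -> rel_mod i r = (K * r)%:E.
  by move=> r0 rd; apply: HK; split=> //; exact: le_lt_trans (mod_mono _ r0 rd) d1.
split=> //; last by apply: HK' => //; exact: ltW.
have := lc s i d (ltW d0) d1; rewrite HK' ?(ltW d0)// lee_fin ler_pdivrMr//.
by rewrite mulrAC -[leLHS]mul1r ler_pM2r.
Qed.

Lemma large_ex (D : R) : exists2 c, large c & D <= c.
Proof.
pose K (s : rel_symb L) (i : 'I_(arity s)) : R := sval (cid2 (Llin i)).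
have K0 (s : rel_symb L) (i : 'I_(arity s)) : 0 < K s i by rewrite /K; case: cid2.
have HK (s : rel_symb L) (i : 'I_(arity s)) r :
    below1 (rel_mod i) r -> rel_mod i r = (K s i * r)%:E.
  by rewrite /K; case: cid2 => k _ /=; exact.
pose V (s : rel_symb L) := \sum_(i < arity s) (K s i)^-1.
have V0 s : 0 <= V s by apply: sumr_ge0 => i _; rewrite invr_ge0 ltW.
pose W := \sum_s V s.
have W0 : 0 <= W by exact: sumr_ge0.
(* [W] sums the inverses of all Lipschitz constants, so it dominates each of them; the other terms
   ensure positivity and the bound by [D]. *)
exists (1 + `|D| + W); last by have := ler_norm D; lra.
have c0 : 0 < 1 + `|D| + W by have := normr_ge0 D; lra.
split=> // s i r r0 ri; rewrite HK// lee_fin ler_pdivrMr// mulrAC.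
rewrite -[leLHS]mul1r ler_wpM2r// -[leLHS](mulfV (lt0r_neq0 (K0 s i))).
rewrite ler_wpM2l ?(ltW (K0 _ _))//.
have le1 : (K s i)^-1 <= V s.
  by rewrite /V (bigD1 i)//= lerDl sumr_ge0// => j _; rewrite invr_ge0 ltW.
have le2 : V s <= W by rewrite /W (bigD1 s)//= lerDl sumr_ge0.
by have := normr_ge0 D; lra.
Qed.

(* If a distance [d] is attained by discarding a proportion [theta] of the
   coordinates, a relation moves by at most [K * (d - c * theta)] on the others,
   and [K * c >= 1] pays for discarding the former in the relation as well. *)
Program Definition pkf (c : R) (c_large : large c) T' T (I : finType)
    (I0 : (0 < #|I|)%N) (f : I -> T' -> T) (P : pstruct L T) : pstruct L T' :=
  @PStruct R L T' (fun x y => kf c (fun i => pd P (f i x) (f i y)))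
    (fun s a => kf 1 (fun i => pr P (f i \o a))) _ _ _ _ _.
Next Obligation.
move=> c [c0 _] T' T I I0 f P x /=.
by under eq_kf do rewrite pdxx; rewrite kf_cst// lexx ltW.
Qed.
Next Obligation.
by move=> c _ T' T I I0 f P x y; apply: eq_kf => i; rewrite pd_sym.
Qed.
Next Obligation.
move=> c [c0 _] T' T I I0 f P y x z.
by apply: kf_tri => [|i]; [exact: ltW|exact: pd_tri].
Qed.
Next Obligation.
by move=> c _ T' T I I0 f P s a; apply: kf_itv => // i; exact: pr_itv.
Qed.
Next Obligation.
move=> c cL T' T I I0 f P s k; set F := fun s a => _.
suff W a b : (forall j, j != k -> a j = b j) ->
    ((F s a - F s b)%:E <= rel_mod k (kf c (fun i => pd P (f i (a k)) (f i (b k)))))%E.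
  move=> a b ab; have W1 := W a b ab.
  have W2 := W b a (fun j jk => esym (ab j jk)).
  have E : kf c (fun i => pd P (f i (a k)) (f i (b k))) =
           kf c (fun i => pd P (f i (b k)) (f i (a k))).
    by apply: eq_kf => i; rewrite pd_sym.
  case: (ger0P (F s a - F s b)) => _; first exact: W1.
  by rewrite opprB E; exact: W2.
move=> ab; set d := kf c _.
have c0 : 0 < c by case: cL.
have d0 : 0 <= d by rewrite /d kf_ge0// ltW.
have F01 x : 0 <= F s x <= 1 by apply: kf_itv => // i; exact: pr_itv.
have [d1|[K [K1 Kd Kr]]] := @mod_below1 s k c d cL d0.
  by apply: le_trans d1; rewrite lee_fin; have := F01 a; have := F01 b; lra.
have K0 : 0 < K by rewrite -(@pmulr_lgt0 _ c)//; lra.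
rewrite Kd lee_fin lerBlDl.
(* [S] is optimal for the distance and [S'] for the relation at [b]; their union serves as a
   competitor for the relation at [a]. *)
have [S HS] := kf_ex c (fun i => pd P (f i (a k)) (f i (b k))).
have [S' HS'] := kf_ex 1 (fun i => pr P (f i \o b)).
rewrite {2}/F HS' {1}/F; apply: le_trans (kf_le _ _ (S :|: S')%SET) _.
set th : R := #|S|%:R / #|I|%:R.
have th0 : 0 <= th by exact: card_ratio_ge0.
have dth : c * th <= d.
  by rewrite /d HS /kfv -/th lerDr bigmax_ge_id.
have Kth : th <= K * (c * th) by rewrite mulrA ler_peMl.
have Kd' : K * (c * th) <= K * d by rewrite ler_pM2l.
have := card_ratioU R S S'; rewrite -/th => cU.
rewrite /kfv; set B := \big[_/_]_(i | i \notin S') _.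
have B0 : 0 <= B by exact: bigmax_ge_id.
suff : \big[Num.max/0]_(i | i \notin (S :|: S')%SET) pr P (f i \o a) <=
    B + (K * d - th) by lra.
apply: bigmax_le => [|i]; first lra.
rewrite inE negb_or => /andP[iS iS'].
have pB : pr P (f i \o b) <= B.
  exact: (@le_bigmax_cond _ _ _ 0 i (fun i => i \notin S') (fun i => pr P (f i \o b))).
have pdi : pd P (f i (a k)) (f i (b k)) <= d - c * th.
  rewrite /d HS /kfv -/th addrK.
  exact: (@le_bigmax_cond _ _ _ 0 i (fun i => i \notin S)
    (fun i => pd P (f i (a k)) (f i (b k)))).
have := @pr_ucont _ _ _ P s k (f i \o a) (f i \o b) _.
rewrite Kr ?pd_ge0//=; last by apply: le_trans pdi _; have := mulr_ge0 (ltW c0) th0; lra.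
move=> /(_ (fun j jk => congr1 (f i) (ab j jk))); rewrite lee_fin => pai.
have Kpd : K * pd P (f i (a k)) (f i (b k)) <= K * (d - c * th) by rewrite ler_pM2l.
have := le_trans (ler_norm _) pai; rewrite mulrBr in Kpd; lra.
Qed.

End linear_moduli.

(** * Cones *)

Section cone.
Variables (R : realType) (L : signature R).
Hypothesis Llin : forall (s : rel_symb L) (i : 'I_(arity s)),
  linear_below1 (rel_mod i).

(** If both minima on the right are distances, [dd] and the triangle inequality for the weights
    conclude. If one of them is a weight, this weight and the two differences already dominate the
    left side. *)
Lemma cone_tri (d1 d2 d3 a b e : R) : 0 <= a -> 0 <= b -> 0 <= e ->
  0 <= d1 -> 0 <= d2 -> d3 <= d1 + d2 ->
  Num.min d3 (Num.min a e) + `|a - e| <=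
    (Num.min d1 (Num.min a b) + `|a - b|) + (Num.min d2 (Num.min b e) + `|b - e|).
Proof.
move=> a0 b0 e0 d10 d20 dd.
have tri : `|a - e| <= `|a - b| + `|b - e|.
  by rewrite -[X in `|X| <= _](subrKA b) ler_normD.
have ab := ler_norm (a - b); have eb := ler_norm (e - b).
rewrite distrC in eb.
have H3 : Num.min d3 (Num.min a e) <= d3 by rewrite ge_min lexx.
have Ha : Num.min d3 (Num.min a e) <= a by rewrite !ge_min lexx !orbT.
have He : Num.min d3 (Num.min a e) <= e by rewrite !ge_min lexx !orbT.
have m1 : 0 <= Num.min d1 (Num.min a b) by rewrite !le_min d10 a0.
have m2 : 0 <= Num.min d2 (Num.min b e) by rewrite !le_min d20 b0.
have Hb : Num.min d3 (Num.min a e) + `|a - e| <= b + `|a - b| + `|b - e|.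
  have := normr_ge0 (a - b); have := normr_ge0 (b - e).
  have /orP[ae|ae] := le_total a e.
    have -> : `|a - e| = e - a by rewrite distrC ger0_norm // subr_ge0.
    lra.
  have -> : `|a - e| = a - e by rewrite ger0_norm // subr_ge0.
  lra.
have min3 (x y z : R) : [\/ Num.min x (Num.min y z) = x,
    Num.min x (Num.min y z) = y | Num.min x (Num.min y z) = z].
  case: (leP y z) => _; [case: (leP x y) => _|case: (leP x z) => _];
  by [constructor 1|constructor 2|constructor 3].
have [E1|E1|E1] := min3 d1 a b; last 2 first; try lra.
by have [E2|E2|E2] := min3 d2 b e; lra.
Qed.

(** [A] and [B] are the weights at the coordinate that changes, and [S] is the contribution of the
    others. If [d] is not truncated, [p - q] is paid for by [K * d] and the change of weight by
    [K * |A - B|], as [1 / c <= K]. If it is truncated, the cone distance is at least [A], while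
    [p <= 1] bounds the first maximum by [A / c]. *)
Lemma cone_lip (c K p q d A B S : R) : 0 < c -> 1 <= K * c ->
  0 <= d -> 0 <= A <= c -> 0 <= B <= c -> 0 <= S -> p <= 1 ->
  (d <= Num.min d (Num.min A B) + `|A - B| -> p - q <= K * d) ->
  Num.max 0 (p - ((c - A) / c + S)) - Num.max 0 (q - ((c - B) / c + S)) <=
    K * (Num.min d (Num.min A B) + `|A - B|).
Proof.
move=> c0 K1 d0 /andP[A0 Ac] /andP[B0 Bc] S0 p1 pq.
have K0 : 0 < K by rewrite -(@pmulr_lgt0 _ c)//; lra.
have vK : c^-1 <= K by rewrite -[leLHS]mul1r ler_pdivrMr.
have cv : c * c^-1 = 1 by rewrite mulfV// gt_eqF.
have v0 : 0 < c^-1 by rewrite invr_gt0.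
set v := c^-1 in vK cv v0 *.
set F := Num.max 0 (q - _).
have F0 : 0 <= F by rewrite /F le_max lexx.
have Fq : q - ((c - B) * v + S) <= F by rewrite /F le_max lexx orbT.
have nAB := normr_ge0 (A - B).
have AB := ler_norm (A - B).
have [dAB|dAB] := leP d (Num.min A B).
  have Kn : (A - B) * v <= K * `|A - B|.
    by apply: le_trans (ler_wpM2r (ltW v0) AB) _; rewrite mulrC ler_wpM2r.
  move: pq; rewrite (min_idPl dAB) => /(_ ltac:(lra)) pq.
  have Kd : 0 <= K * d by rewrite mulr_ge0// ltW.
  have Kn0 : 0 <= K * `|A - B| by rewrite mulr_ge0// ltW.
  by rewrite mulrDr maxEle; case: ifP => _; lra.
have AD : A <= Num.min d (Num.min A B) + `|A - B|.
  by rewrite (min_idPr (ltW dAB)) minEle; case: ifP => _; lra.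
rewrite (min_idPr (ltW dAB)) in AD.
have KA : A * v <= K * (Num.min A B + `|A - B|).
  apply: le_trans (ler_wpM2l A0 vK) _; rewrite mulrC ler_wpM2l// ltW//.
have Av : 0 <= A * v by rewrite mulr_ge0// ltW.
by rewrite maxEle; case: ifP => _; lra.
Qed.

(* The copy of [P] of weight [a] has its distances truncated at [a] and its
   relations lowered by [1 - a / c] per coordinate, so that the copy of weight
   [0] is a single point. *)
Program Definition cone (c : R) (c_large : large L c) (W : Type) (a : W -> R)
    (a_itv : forall w, 0 <= a w <= c) T (P : pstruct L T)
    : pstruct L (W * T) :=
  @PStruct R L (W * T)
    (fun x y => Num.min (pd P x.2 y.2) (Num.min (a x.1) (a y.1)) +
                `|a x.1 - a y.1|)
    (fun s x => Num.max 0 (pr P (fun i => (x i).2) -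
                           \sum_i (c - a (x i).1) / c))
    _ _ _ _ _.
Next Obligation.
move=> c cL W a a01 T P [w x] /=; rewrite pdxx subrr normr0 addr0 minxx.
by apply/min_idPl; case/andP: (a01 w).
Qed.
Next Obligation.
move=> c cL W a a01 T P x y /=; rewrite pd_sym distrC.
by rewrite (minC (a x.1)).
Qed.
Next Obligation.
move=> c cL W a a01 T P y x z /=.
have := a01 x.1; have := a01 y.1; have := a01 z.1.
move=> /andP[z0 _] /andP[y0 _] /andP[x0 _].
by apply: cone_tri => //; [exact: pd_ge0|exact: pd_ge0|exact: pd_tri].
Qed.
Next Obligation.
move=> c [c0 _] W a a01 T P s x /=; rewrite le_max lexx/= ge_max ler01/=.
have /andP[_ p1] := pr_itv P (fun i => (x i).2).
rewrite lerBlDr -[leLHS]addr0 lerD// sumr_ge0// => i _.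
by rewrite divr_ge0 ?(ltW c0)// subr_ge0; case/andP: (a01 (x i).1).
Qed.
Next Obligation.
move=> c cL W a a01 T P s k.
pose F (x : 'I_(arity s) -> W * T) := Num.max 0
  (pr P (fun i => (x i).2) - \sum_i (c - a (x i).1) / c).
pose D (x y : W * T) := Num.min (pd P x.2 y.2) (Num.min (a x.1) (a y.1)) +
  `|a x.1 - a y.1|.
suff H x y : (forall j, j != k -> x j = y j) ->
    ((F x - F y)%:E <= rel_mod k (D (x k) (y k)))%E.
  move=> x y xy; rewrite -/(F x) -/(F y) -/(D (x k) (y k)).
  have H1 := H x y xy; have H2 := H y x (fun j jk => esym (xy j jk)).
  have E : D (x k) (y k) = D (y k) (x k).
    by rewrite /D pd_sym distrC (minC (a (x k).1)).
  case: (ger0P (F x - F y)) => _; first exact: H1.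
  by rewrite opprB E; exact: H2.
move=> xy; have c0 : 0 < c by case: cL.
have mn (z z' : W * T) :
    0 <= Num.min (pd P z.2 z'.2) (Num.min (a z.1) (a z'.1)).
  by rewrite !le_min pd_ge0; case/andP: (a01 z.1) => ->; case/andP: (a01 z'.1) => ->.
have d0 : 0 <= D (x k) (y k) by rewrite addr_ge0.
have F0 z : 0 <= F z by rewrite le_max lexx.
have cs (z : 'I_(arity s) -> W * T) : 0 <= \sum_(i | i != k) (c - a (z i).1) / c.
  apply: sumr_ge0 => i _.
  by rewrite divr_ge0 ?(ltW c0)// subr_ge0; case/andP: (a01 (z i).1).
have p1 : pr P (fun i => (x i).2) <= 1 by case/andP: (pr_itv P (fun i => (x i).2)).
have csxy : \sum_(i | i != k) (c - a (y i).1) / c =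
            \sum_(i | i != k) (c - a (x i).1) / c.
  by apply: eq_bigr => i ik; rewrite xy.
have [d1|[K [K1 Kd Kr]]] := @mod_below1 R L Llin s k c _ cL d0.
  apply: le_trans d1; rewrite lee_fin lerBlDr.
  rewrite -[leLHS]addr0 lerD// /F ge_max ler01/= (bigD1 k)//=.
  have : 0 <= (c - a (x k).1) / c.
    by rewrite divr_ge0 ?(ltW c0)// subr_ge0; case/andP: (a01 (x k).1).
  by have := cs x; lra.
rewrite Kd lee_fin /F (bigD1 k)//= [in X in _ - X <= _](bigD1 k)//= csxy.
apply: cone_lip => //; first exact: pd_ge0.
move=> /Kr; rewrite pd_ge0 => /(_ isT) E.
have := @pr_ucont _ _ _ P s k (fun i => (x i).2) (fun i => (y i).2) _.
move=> /(_ (fun j jk => congr1 snd (xy j jk)))/=; rewrite E lee_fin.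
exact/le_trans/ler_norm.
Qed.

End cone.

(** * Realization of finite structures *)

Section finite_structures.
Variables (R : realType) (L : signature R) (X : finType) (P : pstruct L X).
Hypothesis Psep : forall x y, pd P x y = 0 -> x = y.

(* [Psep] is a phantom argument, from which the metric instance is inferred. *)
Definition fin_metric : Type :=
  (fun _ : forall x y, pd P x y = 0 -> x = y => X) Psep.

HB.instance Definition _ := Choice.on fin_metric.
HB.instance Definition _ := @isMetric.Build R fin_metric (pd P)
  (pdxx P) Psep (pd_sym P) (pd_tri P).

Lemma fin_separation :
  exists2 e : R, 0 < e & forall x y, pd P x y < e -> x = y.
Proof.
exists (\big[Num.min/1]_(p : X * X | p.1 != p.2) pd P p.1 p.2).
  apply: lt_bigmin => // -[x y] /= xy.
  by rewrite lt_neqAle pd_ge0 andbT eq_sym; apply: contra_neq xy => /Psep.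
move=> x y H; apply/eqP/contraT => xy; move: H.
by rewrite ltNge (@bigmin_le_cond _ _ _ 1 (x, y) (fun p => p.1 != p.2)
  (fun p => pd P p.1 p.2)).
Qed.

Definition fin_prestructure : prestructure L :=
  @Prestructure R L fin_metric (pr P) (pr_itv P) (pr_ucont P).

(** A Cauchy filter has a member of diameter below the separation constant, which is a single
    point. *)
Lemma fin_complete (F : set_system fin_prestructure) :
  ProperFilter F -> cauchy F -> exists x : fin_prestructure, F --> x.
Proof.
move=> FF /cauchy_ballP Fc; have [e e0 He] := fin_separation.
have [[A B]/= [FA FB] AB] := Fc _ e0.
have [x Ax] := filter_ex (filterI FA FB).
exists x => V Vx; apply: filterS FB => y By.
have <- : x = y.
  by apply: He; have := AB (x, y) (conj (proj1 Ax) By); rewrite /= ballEmdist.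
exact: nbhs_singleton.
Qed.

Definition fin_structure : structure L := Structure fin_complete.

End finite_structures.

Section realization.
Variables (R : realType) (L : signature R).

Definition preserves T (P : pstruct L T) T' (P' : pstruct L T') (S : set T)
    (f : T -> T') :=
  (forall x y, S x -> S y -> pd P' (f x) (f y) = pd P x y) /\
  (forall s (a : 'I_(arity s) -> T), (forall i, S (a i)) ->
     pr P' (f \o a) = pr P a).

Variables (U : prestructure L) (hU : urysohn U).
Let PU := of_pre U.

(** The Urysohn property applies to genuine finite metric structures, whereas [P] may identify
    points of [S]. The image of [S] in [U] provides a separated model of [S]. *)
Lemma realize_point T (P : pstruct L T) (S : set T) (f : T -> U) (x : T) :
  finite_set S -> preserves P PU S f ->
  exists q : U, preserves P PU (S `|` [set x]) (fun z => if `[<S z>] then f z else q).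
Proof.
move=> finS [fd fr].
(* A point at distance 0 from [S], in particular a point of [S], needs no extension. *)
have [[y [Sy xy]]|nS] := pselect (exists y, S y /\ pd P x y = 0).
  exists (f y); set g := fun z => _.
  pose h z := if `[<S z>] then z else y.
  have gh : g = f \o h by apply/funext => z; rewrite /g /h/=; case: ifP.
  have Sh z : S (h z) by rewrite /h; case: ifPn => [/asboolP|].
  have hz z : (S `|` [set x]) z -> pd P (h z) z = 0.
    rewrite /h; case: ifPn => [_ _|/asboolPn nSz [//|/= ->]]; first exact: pdxx.
    by rewrite pd_sym.
  rewrite gh; split=> [z z' Sz Sz'|s a Sa].
    by rewrite fd//; apply: pd0_eq2; exact: hz.
  rewrite -compA fr => [|i]; last exact: Sh.
  by apply: pr_pd0 => i; apply: hz.
(* The carrier of [M] is the image of [f], with the structure pulled back along a section [sg]; in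
   [N], [None] represents [x]. *)
pose us := fset_set (f @` S).
have usP (u : us) : {z | S z /\ f z = val u}.
  apply: cid; have := valP u; rewrite in_fset_set; last exact: finite_image.
  by rewrite inE => -[z Sz fz]; exists z.
pose sg (u : us) := sval (usP u).
have sgS u : S (sg u) by rewrite /sg; case: (usP u) => z [].
have sgf u : f (sg u) = val u by rewrite /sg; case: (usP u) => z [].
pose sgo (u : option us) := if u is Some u then sg u else x.
pose PN := pull sgo P; pose PM := pull sg P.
have sepM u v : pd PM u v = 0 -> u = v.
  move=> uv; apply: val_inj; apply: mdist_positivity.
  by rewrite -!sgf; move: uv; rewrite /= -fd.
have sepN u v : pd PN u v = 0 -> u = v.
  case: u v => [u|] [v|]//= uv; first by congr Some; apply: sepM.
    by exfalso; apply: nS; exists (sg u); rewrite pd_sym.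
  by exfalso; apply: nS; exists (sg v).
pose M := fin_structure sepM; pose N := fin_structure sepN.
pose e : M -> N := fun u => Some u : option us.
pose phi : M -> U := fun u : us => val u.
have fM : finite_set [set: M].
  exact: (@finite_finset us).
have ope : one_point_extension e.
  split; first by split.
  exists (None : option us); apply/seteqP; split.
    move=> [u|]//= H; exfalso; apply: H; by exists u.
  by move=> _ /= -> [].
have ephi : embedding phi.
  split=> [u v|s a]; first by rewrite /phi -!sgf; apply: fd.
  rewrite /phi -[RHS]/(pr P (sg \o a)) -fr//=.
  by congr interp; apply/funext => i /=; rewrite sgf.
have [psi [pd_psi pr_psi] psi_e] := hU fM ope ephi.
pose q : U := psi (None : option us); exists q; set g := fun z => _.
have fus z : S z -> f z \in us.
  by move=> Sz; rewrite in_fset_set ?inE; [exists z|exact: finite_image].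
(* Every point has a representative in [N] at distance 0, which [psi] sends to the prescribed
   value. *)
have HB z : (S `|` [set x]) z ->
    {b : option us | pd P (sgo b) z = 0 /\ psi b = g z}.
  move=> SUz; apply: cid; rewrite /g; case: (asboolP (S z)) => [Sz|nSz].
    exists (Some [` fus z Sz]%fset); split.
      rewrite -[LHS]fd//; last exact: sgS.
      by rewrite sgf/= mdistxx.
    by rewrite -[LHS]/((psi \o e) [` fus z Sz]%fset) psi_e.
  by exists None; case: SUz => // /= ->; rewrite pdxx.
split=> [z z' Sz Sz'|s a Sa].
  have [b [b0 <-]] := HB z Sz; have [b' [b'0 <-]] := HB z' Sz'.
  rewrite -[LHS]/(mdist (psi b) (psi b')) pd_psi.
  exact: (pd0_eq2 b0 b'0).
pose b i := sval (HB (a i) (Sa i)).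
have b0 i : pd P (sgo (b i)) (a i) = 0 by rewrite /b; case: (HB _ _) => ? [].
have bg i : psi (b i) = g (a i) by rewrite /b; case: (HB _ _) => ? [].
rewrite -(pr_pd0 b0) -[RHS](pr_psi s b).
by congr interp; apply/funext => i /=; rewrite -bg.
Qed.

Lemma preserves_sub T (P : pstruct L T) T' (P' : pstruct L T') (S S' : set T) f :
  S' `<=` S -> preserves P P' S f -> preserves P P' S' f.
Proof.
move=> SS' [fd fr]; split=> [x y /SS' Sx /SS' Sy|s a Sa]; first exact: fd.
by apply: fr => i; exact/SS'.
Qed.

Lemma realize (T : eqType) (P : pstruct L T) (S S' : set T) (f : T -> U) :
  finite_set S -> finite_set S' -> preserves P PU S f ->
  exists2 g : T -> U, preserves P PU (S `|` S') g & forall z, S z -> g z = f z.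
Proof.
move=> fS /finite_seqP[/= us ->]; elim: us S f fS => [|x us IH] S f fS Pf.
  by exists f => //; apply: preserves_sub Pf => z [].
have [q Pq] := realize_point x fS Pf.
have fSx : finite_set (S `|` [set x]) by rewrite finite_setU.
have [g Pg gE] := IH _ _ fSx Pq; exists g => [|z Sz].
  apply: preserves_sub Pg => z [Sz|/=]; first by left; left.
  by rewrite inE => /predU1P[->|zu]; [left; right|right].
by rewrite gE; [rewrite asboolT|left].
Qed.

(** The one-point structure with zero relations is a one-point extension of the empty structure,
    which embeds in any [U]. *)
Lemma urysohn_inh : inhabited U.
Proof.
pose P : pstruct L unit := @PStruct R L unit (fun _ _ => 0) (fun s a => 0)
  (fun _ => erefl) (fun _ _ => erefl) (fun _ _ _ => ltac:(by rewrite addr0))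
  (fun _ _ => ltac:(by rewrite lexx ler01))
  (fun s i _ _ _ => ltac:(by rewrite subr0 normr0 mod_at0)).
have sepN (x y : unit) : pd P x y = 0 -> x = y by case: x; case: y.
have sepM (x y : void) : pd (pull (fun v : void => tt) P) x y = 0 -> x = y by case: x.
pose e : fin_structure sepM -> fin_structure sepN := fun=> tt.
pose phi : fin_structure sepM -> U := fun v : void => match v with end.
have fM : finite_set [set: fin_structure sepM] by exact: (@finite_finset void).
have ope : one_point_extension e.
  split; first by split.
  exists tt; apply/seteqP; split; first by move=> [] _.
  by move=> _ _ [[]].
have ephi : embedding phi.
  split=> [[]|s a].
  by case: (a (Ordinal (arity_gt0 s))).
by have [psi _ _] := hU fM ope ephi; exists; exact: (psi tt).
Qed.

End realization.

(** * Extension from dense subsets *)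

Section dense_extension.
Variables (R : realType) (L : signature R).

Lemma dense_dist (U : metricType R) (D : set U) : dense D ->
  forall (x : U) (e : R), 0 < e -> exists2 z, D z & mdist x z < e.
Proof.
move=> dD x e e0.
have [||z [/interior_subset Bz Dz]] := dD (ball x e)^°.
- by exists x; exact: nbhsx_ballx.
- exact: open_interior.
by exists z => //; move: Bz; rewrite ballEmdist.
Qed.

Lemma interp_near (U : prestructure L) (s : rel_symb L) (e : R) : 0 < e ->
  exists2 d : R, 0 < d & forall a b : 'I_(arity s) -> U,
    (forall i, mdist (a i) (b i) < d) -> `|interp a - interp b| < e.
Proof.
(* Changing [n] coordinates at a cost of [e / n.+1] each keeps the total strictly below [e]. *)
move=> e0; pose n := arity s; pose e' := e / n.+1%:R.
have e'0 : 0 < e' by rewrite divr_gt0.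
have [d d0 Hd] : exists2 d : R, 0 < d & forall (i : 'I_(arity s)) (r : R), 0 <= r -> r < d ->
    (rel_mod i r < e'%:E)%E.
  have H (i : 'I_(arity s)) : {d : R | 0 < d & forall r : R, 0 <= r -> r < d ->
      (rel_mod i r < e'%:E)%E}.
    apply: cid2; have [m0 _ _ mc] := rel_modP i.
    have /mc : nbhs 0%E [set y : \bar R | (y < e'%:E)%E].
      by apply: open_ereal_lt'; rewrite lte_fin.
    rewrite /nbhs/= => -[d /= d0 Hd]; exists d => // r; rewrite le_eqVlt.
    move=> /predU1P[<-|r0 rd]; first by rewrite m0.
    by apply: Hd => //=; rewrite sub0r normrN gtr0_norm.
  pose d i := s2val (H i).
  exists (\big[Num.min/1]_i d i).
    by apply: lt_bigmin => // i _; exact: s2valP (H i).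
  move=> i r r0 rd; apply: (s2valP' (H i)) => //; apply: lt_le_trans rd _.
  exact: bigmin_le_cond.
exists d => // a b ab.
pose h k (i : 'I_(arity s)) := if (i < k)%N then b i else a i.
suff HH k : (k <= n)%N -> `|interp a - interp (h k)| <= k%:R * e'.
  have := HH n (leqnn n); have -> : h n = b.
    by apply/funext => i; rewrite /h ltn_ord.
  move=> /le_lt_trans; apply; rewrite /e' mulrA ltr_pdivrMr// mulrC ltr_pM2l//.
  by rewrite ltr_nat.
elim: k => [_|k IH kn].
  have -> : h 0%N = a by apply/funext => i.
  by rewrite subrr normr0 mul0r.
rewrite -(subrKA (interp (h k))).
apply: le_trans (ler_normD _ _) _; rewrite -natr1 mulrDl mul1r.
apply: lerD; first exact: IH (ltnW kn).
rewrite -lee_fin.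
have := @interp_ucont _ _ U s (Ordinal kn) (h k) (h k.+1) _.
rewrite /h /= ltnSn ltnn => H; apply: le_trans (H _) _.
  move=> j jk; rewrite ltnS [in RHS]leq_eqVlt; case: eqP => //= jk'.
  by case/eqP: jk; exact: val_inj.
by apply/ltW/Hd; [exact: mdist_ge0|exact: ab].
Qed.

Variable U : structure L.

(** [y] is the limit of [f] along [D] at [x], which exists by completeness. Only its distances to
    the image of [D] are recorded; they determine [y] when that image is dense. *)
Lemma isometry_extension (D : set U) (f : U -> U) : dense D ->
  (forall x y, D x -> D y -> mdist (f x) (f y) = mdist x y) ->
  forall x, exists y, forall z, D z -> mdist y (f z) = mdist x z.
Proof.
move=> dD fD x.
pose F := f @ within D (nbhs x).
have FP : ProperFilter F.
  apply: fmap_proper_filter; apply: Build_ProperFilter_ex.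
  move=> P; rewrite /within/= => /nbhs_ballP[e /= e0 He].
  have [z Dz xz] := dense_dist dD x e0.
  by exists z; apply: He => //; rewrite ballEmdist.
have [|y Fy] := struct_complete FP.
  apply/cauchyP => e e0; have e20 : 0 < e / 2 by rewrite divr_gt0.
  have [z Dz xz] := dense_dist dD x e20.
  exists (f z); rewrite /F /within/=.
  apply/nbhs_ballP; exists (e / 2) => //= w; rewrite ballEmdist/= => xw Dw.
  rewrite /= ballEmdist/= fD//; apply: le_lt_trans (metric_triangle z x w) _.
  by rewrite [ltRHS]splitr ltrD// metric_sym.
have Hw (e : R) : 0 < e -> exists w, [/\ D w, mdist x w < e & mdist y (f w) < e].
  move=> e0.
  have : F (ball y e) by apply: Fy; exact: nbhsx_ballx.
  rewrite /F /within/= => /nbhs_ballP[d /= d0 Hd].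
  have m0 : 0 < Num.min d e by rewrite lt_min d0.
  have [w Dw] := dense_dist dD x m0; rewrite lt_min => /andP[xd xe].
  exists w; split=> //; have := Hd w; rewrite ballEmdist/= => /(_ xd Dw).
  by rewrite ballEmdist.
exists y => z Dz; apply/eqP; rewrite eq_le; apply/andP; split;
  apply/ler_addgt0Pl => e e0; have e20 : 0 < e / 2 by rewrite divr_gt0.
- have [w [Dw xw yw]] := Hw _ e20.
  have := metric_triangle y (f w) (f z); rewrite fD//.
  by have := metric_triangle w x z; rewrite (metric_sym w x); lra.
- have [w [Dw xw yw]] := Hw _ e20.
  have := metric_triangle (f w) y (f z); rewrite fD//.
  by have := metric_triangle x w z; rewrite (metric_sym (f w) y); lra.
Qed.

Lemma automorphism_extension (D : set U) (f g : U -> U) : dense D ->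
  (forall x, D x -> D (g x)) -> (forall x, D x -> D (f x)) ->
  (forall x, D x -> f (g x) = x) -> (forall x, D x -> g (f x) = x) ->
  preserves (of_pre U) (of_pre U) D f ->
  exists h : Iso U, forall x, D x -> h x = f x.
Proof.
move=> dD gD fD fgK gfK [fd0 fr].
have fd x y : D x -> D y -> mdist (f x) (f y) = mdist x y by exact: fd0.
have gd x y : D x -> D y -> mdist (g x) (g y) = mdist x y.
  by move=> Dx Dy; rewrite -[RHS](congr2 (@mdist R U) (fgK x Dx) (fgK y Dy)) fd//; exact: gD.
have /choice[F FE] := isometry_extension dD fd.
have /choice[G GE] := isometry_extension dD gd.
(* A point is determined by its distances to a dense set; this makes the extensions of [f] and [g]
   mutually inverse. *)
have near_eq (x y : U) : (forall z, D z -> mdist y z = mdist x z) -> y = x.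
  move=> xy; apply: mdist_positivity; apply/eqP; rewrite eq_le mdist_ge0 andbT.
  apply/ler_addgt0Pl => e e0; have e20 : 0 < e / 2 by rewrite divr_gt0.
  have [z Dz xz] := dense_dist dD x e20.
  by have := metric_triangle y z x; rewrite (xy z Dz) (metric_sym z x); lra.
have FD z : D z -> F z = f z.
  by move=> Dz; apply: mdist_positivity; rewrite FE// mdistxx.
have FG x : F (G x) = x.
  by apply: near_eq => z Dz; rewrite -{1}(fgK z Dz) FE ?GE//; exact: gD.
have GF x : G (F x) = x.
  by apply: near_eq => z Dz; rewrite -{1}(gfK z Dz) GE ?FE//; exact: fD.
have Fd x y : mdist (F x) (F y) = mdist x y.
  apply/eqP; rewrite eq_le; apply/andP; split;
    apply/ler_addgt0Pl => e e0; have e20 : 0 < e / 2 by rewrite divr_gt0.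
  + have [z Dz yz] := dense_dist dD y e20.
    have := metric_triangle (F x) (f z) (F y).
    rewrite (metric_sym (f z)) !(FE _ z Dz).
    by have := metric_triangle x y z; lra.
  + have [z Dz yz] := dense_dist dD y e20.
    have := metric_triangle x z y; have := metric_triangle (F x) (F y) (f z).
    by rewrite !(FE _ z Dz) (metric_sym z y); lra.
have aF : automorphism F.
  split; first by exists G.
  split=> // s a; apply/eqP; rewrite -subr_eq0 -normr_le0.
  apply/ler_addgt0Pl => e e0; have e20 : 0 < e / 2 by rewrite divr_gt0.
  have [d d0 Hd] := interp_near U s e20.
  have /choice[z zE] : forall i, exists z, D z /\ mdist (a i) z < d.
    by move=> i; have [z] := dense_dist dD (a i) d0; exists z.
  have H1 : `|interp (F \o a) - interp (f \o z)| < e / 2.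
    by apply: Hd => i /=; have [Dz az] := zE i; rewrite FE.
  have H2 : `|interp a - interp z| < e / 2 by apply: Hd => i; case: (zE i).
  have H3 : interp (f \o z) = interp z by apply: fr => i; case: (zE i).
  rewrite addr0 ltW// [ltRHS]splitr -(subrKA (interp z)).
  apply: le_lt_trans (ler_normD _ _) _; rewrite ltrD//; first by rewrite -H3.
  by rewrite distrC.
by exists (MkIso aF).
Qed.

Lemma iso_dense_eq (D : set U) (f g : Iso U) : dense D ->
  (forall x, D x -> f x = g x) -> f = g.
Proof.
move=> dD fg; apply: iso_ext => x; apply: mdist_positivity; apply/eqP.
rewrite eq_le mdist_ge0 andbT.
apply/ler_addgt0Pl => e e0; have e20 : 0 < e / 2 by rewrite divr_gt0.
have [z Dz xz] := dense_dist dD x e20.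
have [_ [fd _]] := iso_automorphism f; have [_ [gd _]] := iso_automorphism g.
have := metric_triangle (f x) (f z) (g x); rewrite fd (fg z Dz) gd (metric_sym z); lra.
Qed.

End dense_extension.

(** * Finite groups acting by partial isomorphisms *)

Section group_actions.
Variables (R : realType) (L : signature R) (G : finGroupType).

(* [al] restricts to an action of [G] on [Y] by partial isomorphisms; its
   values outside [Y] are irrelevant. *)
Definition acts T (P : pstruct L T) (Y : set T) (al : G -> T -> T) :=
  [/\ forall g y, Y y -> Y (al g y),
      forall y, Y y -> al 1%g y = y,
      forall g h y, Y y -> al (g * h)%g y = al g (al h y)
    & forall g, preserves P P Y (al g)].

Variable U : structure L.

(** The actions agree where both are defined, hence glue to an action on a dense set. Each element
    then extends to [U], and density transfers the group law. *)
Lemma acts_limit (Y : nat -> set U) (al : nat -> G -> U -> U) :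
  (forall n, acts (of_pre U) (Y n) (al n)) ->
  (forall n, Y n `<=` Y n.+1) ->
  (forall n g y, Y n y -> al n.+1 g y = al n g y) ->
  dense (\bigcup_n Y n) ->
  exists rho : G -> Iso U,
    (forall g h, rho (g * h)%g = (rho g * rho h)%g) /\
    (forall n g y, Y n y -> rho g y = al n g y).
Proof.
move=> aY Yinc alS dY.
have Ymono m n : (m <= n)%N -> Y m `<=` Y n.
  move=> /subnKC <-; elim: (n - m)%N => [|k IH]; first by rewrite addn0.
  by rewrite addnS => x /IH; exact: Yinc.
have alm m n g y : (m <= n)%N -> Y m y -> al n g y = al m g y.
  move=> /subnKC <-; elim: (n - m)%N => [|k IH] Ym; first by rewrite addn0.
  by rewrite addnS alS ?IH//; apply: Ymono Ym; exact: leq_addr.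
pose D := \bigcup_n Y n.
have /choice[lv lvE] : forall x, exists n, D x -> Y n x.
  move=> x; have [[n _ Yx]|nD] := pselect (D x); first by exists n.
  by exists 0%N => /nD.
pose f g x := al (lv x) g x.
have fE n g x : Y n x -> f g x = al n g x.
  move=> Yx; have Dx : D x by exists n.
  have [le|/ltnW le] := leqP n (lv x); first exact: alm.
  by rewrite /f (alm (lv x) n)//; exact: lvE.
have fD g x : D x -> D (f g x).
  by move=> [n _ Yx]; exists n => //; rewrite (fE n)//; case: (aY n) => + _ _ _; exact.
have f1 x : D x -> f 1%g x = x.
  by move=> [n _ Yx]; rewrite (fE n)//; case: (aY n) => _ + _ _; exact.
have fM g h x : D x -> f (g * h)%g x = f g (f h x).
  move=> [n _ Yx]; rewrite !(fE n _ x Yx) (fE n g).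
    by case: (aY n) => _ _ + _; exact.
  by case: (aY n) => + _ _ _; exact.
have fP g : preserves (of_pre U) (of_pre U) D (f g).
  split=> [x y [n _ Yx] [m _ Yy]|s a Da].
    have Yx' : Y (maxn n m) x by apply: Ymono Yx; exact: leq_maxl.
    have Yy' : Y (maxn n m) y by apply: Ymono Yy; exact: leq_maxr.
    by rewrite !(fE (maxn n m))//; case: (aY (maxn n m)) => _ _ _ /(_ g)[+ _]; exact.
  pose n := (\max_i lv (a i))%N.
  have Ya i : Y n (a i).
    by apply: (Ymono (lv (a i))); [exact: (@leq_bigmax _ (fun i => lv (a i)) i)|exact: lvE].
  rewrite (_ : f g \o a = al n g \o a); last first.
    by apply/funext => i /=; exact: fE.
  by case: (aY n) => _ _ _ /(_ g)[_]; exact.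
have ext g : {h : Iso U | forall x, D x -> h x = f g x}.
  apply: cid; apply: (@automorphism_extension _ _ U D (f g) (f g^-1%g)) => //.
  - exact: fD.
  - exact: fD.
  - by move=> x Dx; rewrite -fM// mulgV f1.
  - by move=> x Dx; rewrite -fM// mulVg f1.
exists (fun g => sval (ext g)); split=> [g h|n g y Yy].
  apply: (iso_dense_eq dY) => x Dx; case: (ext _) => k /= ->//.
  case: (ext g) (ext h) => [k1 /= E1] [k2 /= E2].
  by rewrite fM// -[RHS]/(k1 (k2 x)) E2// E1//; exact: fD.
by case: (ext g) => h /= ->; [exact: fE|exists n].
Qed.

End group_actions.

(** * Extension of finite group actions *)

Section action_extension.
Variables (R : realType) (L : signature R).

Lemma bigmax_eqP (I : finType) (F : I -> R) (i0 : I) (v : R) :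
  0 <= v -> F i0 = v -> (forall i, F i <= v) -> \big[Num.max/0]_i F i = v.
Proof.
move=> v0 Fi0 Fv; apply/eqP; rewrite eq_le -{2}Fi0 le_bigmax andbT.
exact: bigmax_le.
Qed.

Lemma separable_seq (U : topologicalType) : separable U -> inhabited U ->
  exists p : nat -> U, dense (range p).
Proof.
move=> [D /countable_injP[f fI] dD] [x0].
exists (fun n => xget x0 [set x | D x /\ f x = n]) => O O0 Oo.
have [x [Ox Dx]] := dD O O0 Oo; exists x; split=> //; exists (f x) => //.
case: xgetP => [y _ [Dy fy]|/(_ x)]; last by case.
by apply: fI; rewrite ?inE.
Qed.

Variable G : finGroupType.

(** [phi] need not be injective, but points with the same image are at distance 0, and so are their
    translates; hence the action descends to the image. *)
Lemma acts_transfer (U : prestructure L) T (P : pstruct L T) (S : set T)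
    (al : G -> T -> T) (phi : T -> U) :
  acts P S al -> preserves P (of_pre U) S phi ->
  exists2 be : G -> U -> U, acts (of_pre U) (phi @` S) be &
    forall g x, S x -> be g (phi x) = phi (al g x).
Proof.
move=> [alS al1 alM alP] [phid phir].
have /choice[r rE] : forall u, exists v : option T,
    (phi @` S) u -> exists x, [/\ v = Some x, S x & phi x = u].
  move=> u; have [[x Sx xu]|nS] := pselect ((phi @` S) u); last by exists None => /nS.
  by exists (Some x) => _; exists x.
pose be g u := if r u is Some x then phi (al g x) else u.
have beE g x : S x -> be g (phi x) = phi (al g x).
  move=> Sx; have [|x' [rx Sx' xx']] := rE (phi x); first by exists x.
  rewrite /be rx; apply: mdist_positivity.
  have := phid (al g x') (al g x); rewrite /= => ->; [|exact: alS|exact: alS].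
  case: (alP g) => -> // _.
  by have := phid x' x; rewrite xx'/= mdistxx => <-.
exists be => //; split.
- by move=> g _ [x Sx <-]; rewrite beE//; exists (al g x) => //; exact: alS.
- by move=> _ [x Sx <-]; rewrite beE// al1.
- by move=> g h _ [x Sx <-]; rewrite !beE// ?alM//; exact: alS.
- move=> g; split=> [_ _ [x Sx <-] [y Sy <-]|s a Sa].
    rewrite !beE// [LHS]phid; [|exact: alS|exact: alS].
    by case: (alP g) => -> // _; rewrite [RHS]phid.
  have /choice[b bE] : forall i, exists x, S x /\ phi x = a i.
    by move=> i; have [x Sx xa] := Sa i; exists x.
  have -> : a = phi \o b by apply/funext => i /=; case: (bE i).
  have Sb i : S (b i) by case: (bE i).
  have -> : be g \o (phi \o b) = phi \o (al g \o b).
    by apply/funext => i /=; rewrite beE.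
  rewrite phir => [|i]; last exact: alS.
  by case: (alP g) => _ ->//; rewrite phir.
Qed.

Variables (U : structure L) (hU : urysohn U).
Let PU := of_pre U.

(** The new orbit is a free copy of [G]. The translates [q g] of [p] are chosen independently and
    need not be compatible; the supremum over [G] restores invariance. *)
Lemma acts_add_point (Y : set U) (al : G -> U -> U) (p : U) :
  finite_set Y -> acts PU Y al ->
  exists Y' al', [/\ finite_set Y', acts PU Y' al', Y `<=` Y', Y' p &
    forall g y, Y y -> al' g y = al g y].
Proof.
move=> fY aY; have [alY al1 alM alP] := aY.
have [Yp|nYp] := pselect (Y p); first by exists Y, al; split.
have /choice[q qP] : forall g, exists q, preserves PU PU (Y `|` [set p])
    (fun z => if `[<Y z>] then al g z else q).
  by move=> g; exact: realize_point.
pose T : eqType := (U + G)%type.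
(* [inr h] stands for the translate of [p] by [h], and [th g x] is the provisional position of the
   translate of [x] by [g]. *)
pose th (g : G) (x : T) : U :=
  match x with inl y => al g y | inr h => q (g * h)%g end.
pose P := psup th PU.
pose S : set T := (inl @` Y) `|` (inr @` [set: G]).
pose S0 : set T := (inl @` Y) `|` [set inr 1%g].
pose phi0 (x : T) : U := match x with inl y => y | inr _ => p end.
pose alT (g : G) (x : T) : T :=
  match x with inl y => inl (al g y) | inr h => inr (g * h)%g end.
have fS : finite_set S.
  by rewrite finite_setU; split; apply: finite_image => //; exact: finite_finset.
have fS0 : finite_set S0 by rewrite finite_setU; split => //; exact: finite_image.
have phi0Y x : S0 x -> (Y `|` [set p]) (phi0 x).
  by move=> [[y Yy <-]|->]; [left|right].
have thE g x : S0 x -> th g x = (if `[<Y (phi0 x)>] then al g (phi0 x) else q g).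
  by move=> [[y Yy <-]|->] /=; [rewrite asboolT|rewrite asboolF// mulg1].
(* Each [th g] is a partial isomorphism on [Y] and [p], so the supremum is taken over equal terms
   there. *)
have Pphi0 : preserves P PU S0 phi0.
  split=> [x y Sx Sy|s a Sa].
    have pdth g : pd PU (th g x) (th g y) = pd PU (phi0 x) (phi0 y).
      by rewrite !thE//; case: (qP g) => + _; apply; exact: phi0Y.
    apply/esym/(@bigmax_eqP _ _ 1%g) => [||g]; first exact: pd_ge0.
      exact: pdth.
    by rewrite pdth.
  have prth g : pr PU (th g \o a) = pr PU (phi0 \o a).
    case: (qP g) => _ /(_ _ (phi0 \o a)) <-; last by move=> i; exact: phi0Y.
    by congr pr; apply/funext => i /=; rewrite thE.
  apply/esym/(@bigmax_eqP _ _ 1%g) => [||g]; first by case/andP: (pr_itv PU (phi0 \o a)).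
    exact: prth.
  by rewrite prth.
have thM g h x : S x -> th g (alT h x) = th (g * h)%g x.
  by move=> [[y Yy <-]|[k _ <-]] /=; [rewrite alM|rewrite mulgA].
have aS : acts P S alT.
  split.
  - move=> g _ [[y Yy <-]|[k _ <-]] /=; last by right; exists (g * k)%g.
    by left; exists (al g y) => //; exact: alY.
  - by move=> _ [[y Yy <-]|[k _ <-]] /=; rewrite ?al1 ?mul1g.
  - by move=> g h _ [[y Yy <-]|[k _ <-]] /=; rewrite ?alM ?mulgA.
  (* Translation by [g] permutes the terms of the supremum. *)
  move=> g; split=> [x y Sx Sy|s a Sa].
    rewrite /P /= [RHS](reindex_inj (mulIg g))/=.
    by apply: eq_bigr => h _; rewrite !thM.
  rewrite /P /= [RHS](reindex_inj (mulIg g))/=.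
  apply: eq_bigr => h _.
  by rewrite (_ : th h \o _ = th (h * g)%g \o a)//; apply/funext => i /=; rewrite thM.
have [phi Pphi phiE] := realize hU fS0 fS Pphi0.
have PphiS : preserves P PU S phi by apply: preserves_sub Pphi => x; right.
have [be aBe beE] := acts_transfer aS PphiS.
have phiY y : Y y -> phi (inl y) = y by move=> Yy; rewrite phiE//; left; exists y.
exists (phi @` S), be; split=> //; first exact: finite_image.
- by move=> y Yy; exists (inl y); [left; exists y|exact: phiY].
- by exists (inr 1%g); [right; exists 1%g|rewrite phiE//; right].
- move=> g y Yy; rewrite -{1}(phiY _ Yy) beE; last by left; exists y.
  by rewrite phiY//; exact: alY.
Qed.

Lemma acts_extend (Y : set U) (al : G -> U -> U) : separable U ->
  finite_set Y -> acts PU Y al ->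
  exists rho : G -> Iso U,
    (forall g h, rho (g * h)%g = (rho g * rho h)%g) /\
    (forall g y, Y y -> rho g y = al g y).
Proof.
move=> hsep fY aY.
have [p dp] := separable_seq hsep (urysohn_inh hU).
pose St : Type := (set U * (G -> U -> U))%type.
pose inv (s : St) := finite_set s.1 /\ acts PU s.1 s.2.
have /choice[nxt nxtE] : forall ns : nat * St, exists s' : St, inv ns.2 ->
    [/\ inv s', ns.2.1 `<=` s'.1, s'.1 (p ns.1) &
      forall g y, ns.2.1 y -> s'.2 g y = ns.2.2 g y].
  move=> [n [Z be]]; have [[/= fZ aZ]|ni] := pselect (inv (Z, be)); last first.
    by exists (Z, be) => /ni.
  have [Y' [al' [fY' aY' YY' Yp alE]]] := acts_add_point (p n) fZ aZ.
  by exists (Y', al') => _; split.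
pose st := fix st n : St := if n is n'.+1 then nxt (n', st n') else (Y, al).
have sti n : inv (st n).
  by elim: n => [//|n IH]; case: (nxtE (n, st n) IH).
have [||||rho [rhoM rhoE]] := @acts_limit _ _ G U (fun n => (st n).1) (fun n => (st n).2).
- by move=> n; case: (sti n).
- by move=> n; case: (nxtE (n, st n) (sti n)).
- by move=> n; case: (nxtE (n, st n) (sti n)).
- move=> O O0 Oo; have [x [Ox [n _ pn]]] := dp O O0 Oo.
  exists x; split=> //; exists n.+1 => //=.
  by case: (nxtE (n, st n) (sti n)) => _ _ /=; rewrite -pn.
by exists rho; split=> // g y Yy; exact: (rhoE 0%N).
Qed.

End action_extension.

(** * Concentration of measure for the Hamming distance *)

Section concentration.
Variable R : realType.

Lemma sum_cst (X : finType) (c : R) : \sum_(x : X) c = #|X|%:R * c.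
Proof. by rewrite sumr_const mulr_natl. Qed.

(** The left side is [#|X| ^ 2] times the variance of [f] for the uniform probability: every
    function that is 1-Lipschitz for [h] has variance at most [v]. *)
Definition variance_le (X : finType) (h : X -> X -> nat) (v : R) :=
  forall f : X -> R, (forall x y, `|f x - f y| <= (h x y)%:R) ->
    #|X|%:R * (\sum_x f x ^+ 2) - (\sum_x f x) ^+ 2 <= v * #|X|%:R ^+ 2.

Lemma variance_le_bij (X Z : finType) (e : X -> Z) h h' v : bijective e ->
  (forall x y, h' (e x) (e y) = h x y) ->
  variance_le h v -> variance_le h' v.
Proof.
move=> be he Vh f fL; have := Vh (f \o e).
rewrite (bij_eq_card be) (reindex e) /=; last exact: onW_bij.
rewrite [\sum_z f z](reindex e) /=; last exact: onW_bij.
by apply=> x y; rewrite -he.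
Qed.

(** The variance is half the mean of [(f x - f y) ^ 2] over all pairs, and each of these squares is
    at most 1. *)
Lemma variance_le_discrete (X : finType) :
  variance_le (fun x y : X => x != y : nat) 1.
Proof.
move=> f fL.
have -> : #|X|%:R * (\sum_x f x ^+ 2) - (\sum_x f x) ^+ 2 =
    2^-1 * \sum_x \sum_y (f x - f y) ^+ 2.
  have -> : \sum_x \sum_y (f x - f y) ^+ 2 =
      \sum_x \sum_(y : X) f x ^+ 2 + \sum_(x : X) \sum_y f y ^+ 2 -
      2 * \sum_x \sum_y f x * f y.
    rewrite mulr_sumr -sumrN -!big_split/=; apply: eq_bigr => x _.
    rewrite mulr_sumr -sumrN -!big_split/=; apply: eq_bigr => y _; ring.
  have -> : \sum_x \sum_(y : X) f x ^+ 2 = #|X|%:R * \sum_x f x ^+ 2.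
    by rewrite mulr_sumr; apply: eq_bigr => x _; rewrite sum_cst.
  have -> : \sum_x \sum_y f x * f y = (\sum_x f x) ^+ 2.
    by rewrite expr2 mulr_suml; apply: eq_bigr => x _; rewrite mulr_sumr.
  by rewrite sum_cst; field.
have le1 : \sum_x \sum_y (f x - f y) ^+ 2 <= \sum_(x : X) \sum_(y : X) (1 : R).
  apply: ler_sum => x _; apply: ler_sum => y _.
  rewrite -real_normK ?num_real// expr_le1//; apply: le_trans (fL x y) _.
  by case: eqP.
have := le1; rewrite !sum_cst mulr1 => le2.
have nn : 0 <= \sum_x \sum_y (f x - f y) ^+ 2.
  by apply: sumr_ge0 => x _; apply: sumr_ge0 => y _; exact: sqr_ge0.
rewrite mul1r expr2; lra.
Qed.

(** Law of total variance: the fibre mean [g] is 1-Lipschitz for [hX], and each restriction of [f]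
    to a fibre is 1-Lipschitz for [hY]. *)
Lemma variance_le_prod (X Y : finType) hX hY (v w : R) : (0 < #|Y|)%N ->
  (forall x, hX x x = 0%N) -> (forall y, hY y y = 0%N) ->
  variance_le hX v -> variance_le hY w ->
  variance_le (fun p q : X * Y => (hX p.1 q.1 + hY p.2 q.2)%N) (v + w).
Proof.
move=> Y0 hX0 hY0 VX VY f fL.
set n : R := #|X|%:R; set k : R := #|Y|%:R.
have k0 : 0 < k by rewrite ltr0n.
have n0 : 0 <= n by [].
pose g x := (\sum_y f (x, y)) / k.
have gL x x' : `|g x - g x'| <= (hX x x')%:R.
  rewrite /g -mulrBl normrM (gtr0_norm (_ : 0 < k^-1)) ?invr_gt0//.
  rewrite ler_pdivrMr// -sumrB; apply: le_trans (ler_norm_sum _ _ _) _.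
  have -> : (hX x x')%:R * k = \sum_(y : Y) (hX x x')%:R.
    by rewrite sum_cst mulrC.
  apply: ler_sum => y _; apply: le_trans (fL _ _) _ => /=.
  by rewrite hY0 addn0.
have kg x : \sum_y f (x, y) = k * g x by rewrite /g mulrC divfK// gt_eqF.
have H1 := VX g gL.
have H2 x : k * (\sum_y f (x, y) ^+ 2) - k ^+ 2 * g x ^+ 2 <= w * k ^+ 2.
  rewrite -exprMn -kg; apply: (VY (fun y => f (x, y))) => y y'.
  by apply: le_trans (fL _ _) _; rewrite /= hX0 add0n.
have H3 : k * (\sum_x \sum_y f (x, y) ^+ 2) - k ^+ 2 * (\sum_x g x ^+ 2) <=
    n * (w * k ^+ 2).
  rewrite !mulr_sumr -sumrB.
  have -> : n * (w * k ^+ 2) = \sum_(x : X) (w * k ^+ 2).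
    by rewrite sum_cst.
  exact: ler_sum.
have nk : #|{: X * Y}|%:R = n * k by rewrite card_prod natrM.
rewrite nk (eq_bigr (fun p => f (p.1, p.2) ^+ 2)); last by case.
rewrite -(pair_bigA _ (fun x y => f (x, y) ^+ 2))/=.
rewrite [\sum_p f p](eq_bigr (fun p => f (p.1, p.2))); last by case.
rewrite -(pair_bigA _ (fun x y => f (x, y)))/=.
have -> : \sum_x \sum_y f (x, y) = k * \sum_x g x.
  by rewrite mulr_sumr; apply: eq_bigr => x _; rewrite kg.
set A := \sum_x \sum_y _ in H3 *; set B := \sum_x g x ^+ 2 in H1 H3.
set C := \sum_x g x in H1 *; rewrite -/n in H1.
have : n * (k * A - k ^+ 2 * B) <= n * (n * (w * k ^+ 2)) by rewrite ler_wpM2l.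
have : k ^+ 2 * (n * B - C ^+ 2) <= k ^+ 2 * (v * n ^+ 2).
  by rewrite ler_wpM2l// sqr_ge0.
lra.
Qed.

Lemma card_hcube (X : finType) m :
  #|{dffun forall _ : 'I_m, X}| = (#|X| ^ m)%N.
Proof. by rewrite (card_ffun 'I_m X) card_ord. Qed.

Definition hamming (X : finType) m (x y : {dffun forall _ : 'I_m, X}) : nat :=
  \sum_i (x i != y i).

Lemma variance_le_hamming (X : finType) m : (0 < #|X|)%N ->
  variance_le (@hamming X m) m%:R.
Proof.
move=> X0; have /card_gt0P[a _] := X0; elim: m => [|m IH].
  move=> f _; have -> : #|{dffun forall _ : 'I_0, X}|%:R = 1 :> R.
    by rewrite card_hcube expn0.
  pose x0 : {dffun forall _ : 'I_0, X} := [ffun=> a].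
  have E (F : {dffun forall _ : 'I_0, X} -> R) : \sum_x F x = F x0.
    rewrite (bigD1 x0)//= big1 ?addr0// => x /eqP xx0; exfalso; apply: xx0.
    by apply/ffunP => -[].
  by rewrite !E mul1r subrr mul0r.
pose e (p : X * {dffun forall _ : 'I_m, X}) : {dffun forall _ : 'I_m.+1, X} :=
  [ffun i => if unlift ord0 i is Some j then p.2 j else p.1].
pose e' (z : {dffun forall _ : 'I_m.+1, X}) : X * {dffun forall _ : 'I_m, X} :=
  (z ord0, [ffun j => z (lift ord0 j)]).
have be : bijective e.
  exists e'.
    move=> [a' x]; rewrite /e' /e; congr pair; first by rewrite ffunE unlift_none.
    by apply/ffunP => j; rewrite !ffunE liftK.
  move=> z; apply/ffunP => i; rewrite ffunE /=.
  by case: unliftP => [j ->|->//]; rewrite ffunE.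
rewrite -natr1 addrC.
apply: (variance_le_bij be) (variance_le_prod _ _ _ (@variance_le_discrete X) IH).
- move=> [a' x] [b y]; rewrite /hamming big_ord_recl !ffunE unlift_none/=.
  by congr addn; apply: eq_bigr => i _; rewrite !ffunE liftK.
- by rewrite card_hcube expn_gt0 X0.
- by move=> x; rewrite eqxx.
- by move=> y; rewrite /hamming big1// => i _; rewrite eqxx.
Qed.

Lemma hamming_tri (X : finType) m (x y z : {dffun forall _ : 'I_m, X}) :
  (hamming x z <= hamming x y + hamming y z)%N.
Proof.
rewrite /hamming -big_split/=; apply: leq_sum => i _.
by case: (eqVneq (x i) (y i)) => [->//|_]; case: (x i != z i).
Qed.

Lemma hamming_sym (X : finType) m (x y : {dffun forall _ : 'I_m, X}) :
  hamming x y = hamming y x.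
Proof. by apply: eq_bigr => i _; rewrite eq_sym. Qed.

(** The distance [f] to [B] is 1-Lipschitz, so its variance is at most [m]. Chebyshev's inequality
    is used twice: on [B], where [f] vanishes, to bound the mean by [t / 2], then on the points
    where [f] is at least [t]. *)
Lemma hamming_concentration (X : finType) m (d t : R)
    (B : {pred {dffun forall _ : 'I_m, X}}) :
  (0 < #|X|)%N -> 0 < d -> 0 < t -> 4 * m%:R <= d * t ^+ 2 ->
  d * #|{dffun forall _ : 'I_m, X}|%:R <= #|B|%:R ->
  #|[pred x | ~~ [exists b, (b \in B) && ((hamming x b)%:R < t)]]|%:R <=
    d * #|{dffun forall _ : 'I_m, X}|%:R.
Proof.
move=> X0 d0 t0 mdt dB.
set N : R := #|{dffun forall _ : 'I_m, X}|%:R in dB *.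
have N0 : 0 < N.
  by rewrite ltr0n card_hcube expn_gt0 X0.
have [b0 b0B] : exists b0, b0 \in B.
  apply/existsP; rewrite -[X in is_true X]negbK negb_exists; apply/negP => /forallP nB.
  have : #|B| = 0%N by apply: eq_card0 => b; apply/negbTE/nB.
  by move=> B0; move: dB; rewrite B0 leNgt mulr_gt0.
pose nr x := [arg min_(b < b0 in B) hamming x b].
have nrB x : nr x \in B by rewrite /nr; case: arg_minnP.
have nr_le x b : b \in B -> (hamming x (nr x) <= hamming x b)%N.
  by rewrite /nr; case: arg_minnP => // c _; apply.
pose f x : R := (hamming x (nr x))%:R.
have fB b : b \in B -> f b = 0.
  move=> bB; have := nr_le b b bB.
  by rewrite /f {2}/hamming big1 ?leqn0 => [/eqP ->//|i _]; rewrite eqxx.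
have fL1 x y : f x <= f y + (hamming x y)%:R.
  rewrite -natrD ler_nat; apply: leq_trans (nr_le x (nr y) (nrB y)) _.
  by rewrite addnC hamming_tri.
have fL x y : `|f x - f y| <= (hamming x y)%:R.
  by rewrite ler_norml; have := fL1 x y; have := fL1 y x; rewrite (hamming_sym y); lra.
have := variance_le_hamming X0 fL; rewrite -/N.
set S1 := \sum_x f x; set S2 := \sum_x _ => V.
pose E := S1 / N.
have SE : S1 = N * E by rewrite /E mulrC divfK// gt_eqF.
have W : \sum_x (f x - E) ^+ 2 <= m%:R * N.
  have -> : \sum_x (f x - E) ^+ 2 = S2 - N * E ^+ 2.
    have -> : \sum_x (f x - E) ^+ 2 = \sum_x (f x ^+ 2 + (- (2 * E)) * f x + E ^+ 2).
      by apply: eq_bigr => x _; ring.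
    rewrite !big_split/= -mulr_sumr -/S1 -/S2 sum_cst -/N SE.
    by ring.
  rewrite -(ler_pM2l N0); move: V; rewrite SE.
  by lra.
(* Chebyshev's inequality for a set of points far from the mean. *)
have sub (Q : {pred {dffun forall _ : 'I_m, X}}) (s : R) :
    (forall x, x \in Q -> s <= (f x - E) ^+ 2) ->
    #|Q|%:R * s <= m%:R * N.
  move=> Qs; apply: le_trans W.
  rewrite [leRHS](bigID (mem Q))/= -[leLHS]addr0; apply: lerD.
    by rewrite mulr_natl -sumr_const; apply: ler_sum => x /Qs.
  by apply: sumr_ge0 => x _; exact: sqr_ge0.
have Et : E <= t / 2.
  rewrite leNgt; apply/negP => tE.
  have B1 : #|B|%:R * E ^+ 2 <= m%:R * N.
    by apply: sub => x xB; rewrite fB// sub0r sqrrN.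
  have B2 : d * N * E ^+ 2 <= #|B|%:R * E ^+ 2 by rewrite ler_wpM2r// sqr_ge0.
  have B3 : (t / 2) ^+ 2 < E ^+ 2.
    by rewrite ltr_pXn2r// nnegrE; lra.
  have B4 : (d * E ^+ 2) * N <= m%:R * N by apply: le_trans B1; rewrite mulrAC.
  rewrite (ler_pM2r N0) in B4.
  have B5 : d * (t / 2) ^+ 2 < d * E ^+ 2 by rewrite ltr_pM2l.
  by move: B5; rewrite expr_div_n; lra.
set Q := [pred x | _].
have Q1 : #|Q|%:R * (t / 2) ^+ 2 <= m%:R * N.
  apply: (sub Q) => x; rewrite inE negb_exists => /forallP /(_ (nr x)).
  rewrite nrB/= -leNgt => tf.
  have fE : t / 2 <= f x - E by have : t <= f x := tf; lra.
  by rewrite ler_pXn2r// nnegrE; lra.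
have Q2 : m%:R * N <= (d * N) * (t / 2) ^+ 2.
  by rewrite mulrAC ler_pM2r// expr_div_n; lra.
by have := le_trans Q1 Q2; rewrite ler_pM2r// exprn_gt0// divr_gt0.
Qed.

End concentration.

(** * Approximating an automorphism by a permutation *)

(** By induction, the permutation obtained for the tail is followed by a transposition that corrects
    the value at [x] and fixes the images of the tail. *)
Lemma perm_extend (X : finType) (f : X -> X) (l : seq X) :
  {in l &, injective f} -> exists s : {perm X}, {in l, s =1 f}.
Proof.
elim: l => [|x l IH] finj; first by exists 1%g.
have [s sE] : exists s : {perm X}, {in l, s =1 f}.
  by apply: IH => y z yl zl; apply: finj; rewrite inE ?yl ?zl orbT.
have [xl|xl] := boolP (x \in l).
  by exists s => y; rewrite inE => /predU1P[->|]; exact: sE.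
exists (s * tperm (s x) (f x))%g => y; rewrite inE permM => /predU1P[->|yl].
  by rewrite tpermL.
have yx : x != y by apply: contraNneq xl => ->.
have sxy : s x != s y by rewrite (inj_eq perm_inj).
have fxy : f x != s y.
  rewrite sE//; apply: contraNneq yx => /finj -> //; first exact: mem_head.
  by rewrite inE yl orbT.
by rewrite tpermD// sE.
Qed.

Section approximate_extension.
Variables (R : realType) (L : signature R) (U : prestructure L).
Variables (G : finGroupType) (rho : G -> Iso U) (gamma : Iso U).
Hypothesis rhoM : forall g h, rho (g * h)%g = (rho g * rho h)%g.

Lemma hom1 : rho 1%g = 1%g.
Proof. by apply: (mulgI (rho 1%g)); rewrite -rhoM !mulg1. Qed.

(** Words with at most [k] letters [gamma] or its inverse, interspersed with elements of [rho G].
    Ending with such an element makes each ball stable under right multiplication by [rho G]; the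
    letter 1 makes the balls increase. *)
Fixpoint ball_seq k : seq (Iso U) :=
  if k is k'.+1 then
    [seq (p * rho h)%g |
      p <- [seq (w * g)%g | w <- ball_seq k', g <- [:: 1%g; gamma; gamma^-1%g]],
      h <- enum G]
  else [seq rho h | h <- enum G].

Lemma ball_rho k w h : w \in ball_seq k -> (w * rho h)%g \in ball_seq k.
Proof.
case: k => [/mapP[a _ ->]|k /= /allpairsP[[p a] [/= pk _ ->]]].
  by rewrite -rhoM; apply/mapP; exists (a * h)%g => //; exact: mem_enum.
apply/allpairsP; exists (p, (a * h)%g); split=> //=; first exact: mem_enum.
by rewrite rhoM mulgA.
Qed.

Lemma ballS k w g : w \in ball_seq k -> g \in [:: 1%g; gamma; gamma^-1%g] ->
  (w * g)%g \in ball_seq k.+1.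
Proof.
move=> wk gk; rewrite -(mulg1 (w * g)%g) -hom1.
by apply: (allpairs_f (fun p h => (p * rho h)%g)) (mem_enum _ _);
  exact: (allpairs_f (fun w g => (w * g)%g)).
Qed.

Lemma ball_gamma k w : w \in ball_seq k -> (w * gamma)%g \in ball_seq k.+1.
Proof. by move=> wk; apply: ballS; rewrite // !inE eqxx orbT. Qed.

Lemma ball_gammaV k w : w \in ball_seq k -> (w * gamma^-1)%g \in ball_seq k.+1.
Proof. by move=> wk; apply: ballS; rewrite // !inE eqxx !orbT. Qed.

Lemma ball_le k n w : (k <= n)%N -> w \in ball_seq k -> w \in ball_seq n.
Proof.
move=> /subnKC <-; elim: (n - k)%N => [|m IH wk]; first by rewrite addn0.
by rewrite addnS -(mulg1 w); apply: ballS; rewrite ?IH// inE eqxx.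
Qed.

Lemma ball1 k : 1%g \in ball_seq k.
Proof.
apply: (@ball_le 0%N) => //=; apply/mapP.
by exists 1%g; rewrite ?hom1// mem_enum.
Qed.

(** As the balls increase, this is [n] minus the least radius of a ball containing [w], or 0 if that
    radius is not below [n]. *)
Definition depth n (w : Iso U) : nat := \sum_(k < n) (w \in ball_seq k).

Lemma depth_le n w : (depth n w <= n)%N.
Proof.
rewrite -[leqRHS]card_ord -sum1_card; apply: leq_sum => i _; exact: leq_b1.
Qed.

Lemma depth1 n : depth n 1%g = n.
Proof.
rewrite /depth (eq_bigr (fun=> 1%N)) ?sum1_card ?card_ord// => i _.
by rewrite ball1.
Qed.

Lemma depth_rho n w h : depth n (w * rho h)%g = depth n w.
Proof.
apply: eq_bigr => i _; congr nat_of_bool; apply/idP/idP; last exact: ball_rho.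
move=> /(@ball_rho _ _ h^-1%g); rewrite -mulgA -rhoM mulgV hom1 mulg1//.
Qed.

(** Each radius counted for [w], except possibly the last, gives the next radius for [w']. *)
Lemma depth_shift n w w' :
  (forall k, w \in ball_seq k -> w' \in ball_seq k.+1) ->
  (depth n w <= (depth n w').+1)%N.
Proof.
move=> ww'; case: n => [|n]; first by rewrite /depth !big_ord0.
rewrite /depth big_ord_recr /= -addn1; apply: leq_add; last exact: leq_b1.
rewrite big_ord_recl; apply: leq_trans (leq_addl _ _); apply: leq_sum => i _.
by case: (boolP (w \in _)) => // /ww' /= ->.
Qed.

Lemma depth_eq0 n w : (forall k, (k < n)%N -> w \notin ball_seq k) ->
  depth n w = 0%N.
Proof. by move=> H; rewrite /depth big1// => i _; rewrite (negbTE (H _ _)). Qed.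

Variables (Y : set U) (c e : R).
Hypothesis (Llin : forall (s : rel_symb L) (i : 'I_(arity s)),
  linear_below1 (rel_mod i)).
Hypotheses (c_large : large L c) (e0 : 0 < e).
Hypothesis Yc : forall y z, Y y -> Y z -> mdist y z <= c.

(* The elements of the ball of radius [n] serve as coordinates: right
   multiplication by [gamma], defined except at the boundary, extends to a
   permutation, and the cone weights, which decrease to [0] at the boundary,
   hide the wrong values of this extension. *)
Lemma approximate_extension :
  exists (H : finGroupType) (Q : pstruct L (H * U)) (j : G -> H) (t : H),
  [/\ forall g h, j (g * h)%g = (j g * j h)%g,
      forall g, preserves Q Q setT (fun x => ((g * x.1)%g, x.2)),
      preserves (of_pre U) Q Y (fun y => (1%g, y)),
      forall h y, pd Q (j h, y) (1%g, rho h y) = 0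
    & forall y, pd Q (t, y) (1%g, gamma y) <= e].
Proof.
have c0 : 0 < c by case: c_large.
(* The weights change by at most [c / n] when the depth changes by 1. *)
pose n := (Num.trunc (c / e)).+1.
have nP : c / n%:R <= e.
  rewrite ler_pdivrMr ?ltr0n// mulrC -ler_pdivrMr//.
  by apply/ltW/truncnS_gt; rewrite divr_ge0// ltW.
pose X : finType := seq_sub (ball_seq n).
pose wt (x : X) : R := c * ((depth n (ssval x))%:R / n%:R).
have wtP x : 0 <= wt x <= c.
  rewrite mulr_ge0 ?divr_ge0 ?(ltW c0)//= ler_piMr ?(ltW c0)//.
  by rewrite ler_pdivrMr ?ltr0n// mul1r ler_nat depth_le.
pose C := cone Llin c_large wtP (of_pre U).
pose H : finGroupType := {perm X}.
(* A permutation moves both the cone weight and the group element applied to the point of [U]. *)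
pose co (x : X) (p : H * U) : X * U := (p.1 x, ssval (p.1 x) p.2).
pose Q := psup co C.
pose jf (h : G) (x : X) : X := SeqSub (ball_rho h (ssvalP x)).
have jf_inj h : injective (jf h).
  by move=> x y /(congr1 (@ssval _ _)) /= /mulIg xy; exact: val_inj.
pose j (h : G) : H := perm (@jf_inj h).
pose A := [seq x <- enum X | (ssval x * gamma)%g \in ball_seq n].
pose tf (x : X) : X := insubd x (ssval x * gamma)%g.
have tfE x : x \in A -> ssval (tf x) = (ssval x * gamma)%g.
  by rewrite mem_filter => /andP[xA _]; rewrite /tf -[ssval _]/(val _) val_insubd xA.
have [t tE] : exists t : H, {in A, t =1 tf}.
  apply: perm_extend => x y xA yA /(congr1 (@ssval _ _)); rewrite !tfE// => /mulIg.
  exact: val_inj.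
exists H, Q, j, t; split.
- move=> g h; apply/permP => x; rewrite permM !permE; apply: val_inj => /=.
  by rewrite rhoM mulgA.
- move=> g; split=> [x y _ _|s a _].
    rewrite /Q /= [RHS](reindex_inj (@perm_inj _ g)) /=.
    by apply: eq_bigr => w _; rewrite !permM.
  rewrite /Q /= [RHS](reindex_inj (@perm_inj _ g)) /=.
  apply: eq_bigr => w _; congr (Num.max 0 (_ - _)).
    by congr interp; apply/funext => i /=; rewrite permM.
  by apply: eq_bigr => i _; rewrite permM.
- pose x1 : X := SeqSub (ball1 n).
  have wt1 : wt x1 = c by rewrite /wt /= depth1 divff ?mulr1// pnatr_eq0.
  have isoP (f : Iso U) : embedding f by case: (iso_automorphism f).
  split=> [y z Yy Yz|s a Ya].
    apply: (@bigmax_eqP _ _ _ x1) => [||w]; rewrite /= ?perm1.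
    + exact: mdist_ge0.
    + rewrite wt1 subrr normr0 addr0 minxx; apply/min_idPl; exact: Yc.
    + by rewrite subrr normr0 addr0 (isoP (ssval w)).1 ge_min lexx.
  have prE (w : X) : interp (fun i => ssval w (a i)) = interp a.
    exact: (isoP (ssval w)).2.
  apply: (@bigmax_eqP _ _ _ x1) => [||w].
  + by case/andP: (interp_itv a).
  + rewrite /= [X in Num.max 0 (_ - X)]big1 => [|i _]; last first.
      by rewrite perm1 wt1 subrr mul0r.
    rewrite subr0 (_ : (fun i => _) = (fun i => ssval x1 (a i))); last first.
      by apply/funext => i; rewrite perm1.
    by rewrite prE; apply/max_idPr; case/andP: (interp_itv a).
  + rewrite /= (_ : (fun i => _) = (fun i => ssval w (a i))); last first.
      by apply/funext => i; rewrite perm1.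
    rewrite prE ge_max; have /andP[-> _] := interp_itv a.
    rewrite lerBlDr lerDl sumr_ge0// => i _; rewrite perm1 divr_ge0 ?(ltW c0)//.
    by rewrite subr_ge0; case/andP: (wtP w).
- move=> h y; apply/eqP; rewrite eq_le pd_ge0 andbT.
  apply: bigmax_le => // w _; rewrite /= perm1 permE /= /wt/= depth_rho subrr.
  by rewrite normr0 addr0 ge_min mdistxx lexx.
- move=> y; apply: bigmax_le => [|w _]; first exact: ltW.
  rewrite /co /= perm1.
  (* On [A] the two coordinates have the same point of [U], and only their weights differ. *)
  have [wA|wA] := boolP (w \in A).
    rewrite tE// /wt tfE// [iso_fun (_ * _)%g y]/(ssval w (gamma y)) mdistxx.
    apply: le_trans nP.
    have le1 := depth_shift n (fun k => @ball_gamma k (ssval w)).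
    have le2 : (depth n (ssval w * gamma)%g <= (depth n (ssval w)).+1)%N.
      apply: depth_shift => k /ball_gammaV; by rewrite mulgK.
    set d' := depth n (_ * _)%g in le1 le2 *; set d := depth n _ in le1 le2 *.
    have d1 : `|d'%:R - d%:R| <= 1 :> R.
      have l1 : d%:R <= d'%:R + 1 :> R by rewrite natr1 ler_nat.
      have l2 : d'%:R <= d%:R + 1 :> R by rewrite natr1 ler_nat.
      by rewrite ler_norml; lra.
    have m0 : Num.min 0 (Num.min (c * (d'%:R / n%:R)) (c * (d%:R / n%:R))) <= 0.
      by rewrite ge_min lexx.
    apply: le_trans (lerD m0 (lexx _)) _; rewrite add0r.
    rewrite -mulrBr -mulrBl normrM (gtr0_norm c0) normrM.
    rewrite (ger0_norm (_ : 0 <= n%:R^-1)) ?invr_ge0// mulrCA.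
    by rewrite ler_piMl// divr_ge0// ltW.
  (* Off [A] both weights are 0, so both coordinates are the apex of the cone. For [t w], a positive
     weight would make it the value of [t] at a point of [A] as well, against injectivity. *)
  have out (w' : X) : ((ssval w') * gamma)%g \notin ball_seq n -> wt w' = 0.
    move=> nw; rewrite /wt depth_eq0 ?mul0r ?mulr0// => k kn.
    by apply: contra nw => /ball_gamma; exact: ball_le.
  have w0 : wt w = 0.
    by apply: out; apply: contra wA => wA; rewrite mem_filter wA mem_enum.
  have tw0 : wt (t w) = 0.
    rewrite /wt depth_eq0 ?mul0r ?mulr0// => k kn; apply/negP => tk.
    have tk' : (ssval (t w) * gamma^-1)%g \in ball_seq n.
      by apply: ball_le kn _; exact: ball_gammaV.
    pose w' : X := SeqSub tk'.
    have w'A : w' \in A.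
      by rewrite mem_filter /= mem_enum mulgKV ssvalP.
    have : t w' = t w.
      by rewrite tE//; apply: val_inj; rewrite [LHS]tfE// /= mulgKV.
    by move/perm_inj => ww'; move: wA; rewrite -ww' w'A.
  rewrite tw0 w0 subrr normr0 addr0 minxx; apply: le_trans (ltW e0).
  by rewrite ge_min lexx orbT.
Qed.

End approximate_extension.

(** * One step of the construction *)

Lemma finite_bounded (R : realType) (T : eqType) (A : set T) (f : T -> R) :
  finite_set A -> exists D, forall x, A x -> f x <= D.
Proof.
move=> /finite_seqP[s ->]; elim: s => [|x s [D HD]]; first by exists 0.
exists (Num.max (f x) D) => y /=; rewrite inE le_max => /predU1P[->|ys].
  by rewrite lexx.
by rewrite HD ?orbT.
Qed.

Section step.
Variables (R : realType) (L : signature R) (U : structure L).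
Hypothesis (Llin : forall (s : rel_symb L) (i : 'I_(arity s)),
  linear_below1 (rel_mod i)).
Hypotheses (hU : urysohn U) (hsep : separable U).
Variables (G : finGroupType) (rho : G -> Iso U) (gamma : Iso U).
Hypothesis rhoM : forall g h, rho (g * h)%g = (rho g * rho h)%g.
Variables (F : set U) (e : R).
Hypotheses (Ffin : finite_set F) (e0 : 0 < e).

(** The new group is a power of the group from [approximate_extension], with [i] diagonal. Its
    action on [U] is built afresh outside a finite set, so it is compared with [rho] on [F] only. *)
Lemma levy_step :
  exists (G' : finGroupType) (rho' : G' -> Iso U) (Y : set U) (i : G -> G'),
  [/\ forall g h, rho' (g * h)%g = (rho' g * rho' h)%g,
      forall g h, i (g * h)%g = (i g * i h)%g,
      [/\ finite_set Y, F `<=` Y & forall g y, Y y -> Y (rho' g y)],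
      (forall h y, F y -> rho' (i h) y = rho h y) /\
      (exists t, forall y, F y -> mdist (rho' t y) (gamma y) <= e)
    & forall B : {pred G'}, e * #|G'|%:R <= #|B|%:R ->
        #|[pred g | ~~ [exists b, (b \in B) &&
            `[<forall x, F x -> mdist (rho' (g * b^-1)%g x) x < e>]]]|%:R
          <= e * #|G'|%:R].
Proof.
pose Y1 : set U := \bigcup_(h in [set: G]) (rho h @` (F `|` gamma @` F)).
have fY1 : finite_set Y1.
  apply: bigcup_finite => [|h _]; first exact: finite_finset.
  by apply: finite_image; rewrite finite_setU; split=> //; exact: finite_image.
have Y1rho h y : Y1 y -> Y1 (rho h y).
  move=> [k _ [z Fz <-]]; exists (h * k)%g => //; exists z => //.
  by rewrite rhoM.
have rho1 : rho 1%g = 1%g by exact: hom1.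
have FY1 y : F y -> Y1 y.
  by move=> Fy; exists 1%g => //; exists y; [left|rewrite rho1].
have gY1 y : F y -> Y1 (gamma y).
  by move=> Fy; exists 1%g => //; exists (gamma y); [right; exists y|rewrite rho1].
have [D HD] := finite_bounded (fun p => mdist p.1 p.2) (finite_setX fY1 fY1).
have [c c_large Dc] := large_ex Llin D.
have c0 : 0 < c by case: c_large.
have Y1c y z : Y1 y -> Y1 z -> mdist y z <= c.
  by move=> Yy Yz; apply: le_trans Dc; exact: (HD (y, z)).
have [H [Q [j [t [jM Qinv Q1 Qj Qt]]]]] :=
  approximate_extension gamma rhoM Llin c_large e0 Y1c.
(* This is the size that [hamming_concentration] requires for the proportion [e] and the radius
   [e * m / c]; discarding fewer coordinates than this radius costs less than [e]. *)
pose m := (Num.trunc (4 * c ^+ 2 / e ^+ 3)).+1.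
have mP : 4 * m%:R <= e * (e * m%:R / c) ^+ 2.
  have H1 : 4 * c ^+ 2 / e ^+ 3 <= m%:R by exact/ltW/truncnS_gt.
  have m0 : 0 < m%:R :> R by rewrite ltr0n.
  rewrite ler_pdivrMr ?exprn_gt0// in H1.
  have -> : e * (e * m%:R / c) ^+ 2 = m%:R * e ^+ 3 * m%:R / c ^+ 2.
    by field; rewrite gt_eqF.
  by rewrite ler_pdivlMr ?exprn_gt0// mulrAC ler_pM2r.
have I0 : (0 < #|'I_m|)%N by rewrite card_ord.
pose Hm : finGroupType := {dffun forall _ : 'I_m, H}.
pose co (k : 'I_m) (x : Hm * U) : H * U := (x.1 k, x.2).
pose P := pkf Llin c_large I0 co Q.
pose S : set (Hm * U) := [set: Hm] `*` Y1.
pose S0 : set (Hm * U) := [set 1%g] `*` Y1.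
have fS : finite_set S by apply: finite_setX => //; exact: finite_finset.
have fS0 : finite_set S0 by exact: finite_setX.
have co1 k y : co k (1%g, y) = (1%g, y) by rewrite /co ffunE.
have P0 : preserves P (of_pre U) S0 snd.
  split=> [[? y] [? z] [/= -> Yy] [/= -> Yz]|s a Sa].
    rewrite /P [RHS]/=; under eq_kf do rewrite !co1.
    by case: Q1 => + _ => ->//; rewrite kf_cst//= mdist_ge0 Y1c.
  have aE : a = (fun y => (1%g, y)) \o (fun i => (a i).2).
    by apply/funext => i /=; case: (a i) (Sa i) => ? ? [/= ->].
  rewrite /P [RHS]/=.
  have E k : co k \o a = (fun y => (1%g, y)) \o (fun i => (a i).2).
    by rewrite aE; apply/funext => i /=; exact: co1.
  under eq_kf do rewrite E.
  case: Q1 => _ ->; last by move=> i; case: (Sa i).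
  by rewrite kf_cst//; exact: (pr_itv (of_pre U)).
have [phi Pphi phiE] := realize hU fS0 fS P0.
have phi1 y : Y1 y -> phi (1%g, y) = y by move=> Yy; rewrite phiE.
have PphiS : preserves P (of_pre U) S phi by apply: preserves_sub Pphi => x; right.
pose al (g : Hm) (x : Hm * U) := ((g * x.1)%g, x.2).
have aS : acts P S al.
  split=> [g [x y] [_ Yy]|[x y] _|g h [x y] _|g]; rewrite /al/=.
  - by [].
  - by rewrite mul1g.
  - by rewrite mulgA.
  have E k : co k \o al g = (fun x => (g k * x.1, x.2)%g) \o co k.
    by apply/funext => x; rewrite /co /al /= ffunE.
  split=> [x y _ _|s a _].
    apply: eq_kf => k; rewrite -[co k _]/((co k \o al g) x).
    rewrite -[co k (_, y.2)]/((co k \o al g) y) E.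
    by case: (Qinv (g k)) => ->.
  apply: eq_kf => k; rewrite compA E -compA.
  by case: (Qinv (g k)) => _ ->.
have [be aBe beE] := acts_transfer aS PphiS.
have [rho' [rho'M rho'E]] := acts_extend hU hsep (finite_image phi fS) aBe.
have rphi g x y : Y1 y -> rho' g (phi (x, y)) = phi ((g * x)%g, y).
  by move=> Yy; rewrite rho'E ?beE//; exists (x, y).
have r1 g y : Y1 y -> rho' g y = phi (g, y).
  by move=> Yy; rewrite -{1}(phi1 y Yy) rphi// mulg1.
have dphi x x' y y' : Y1 y -> Y1 y' ->
    mdist (phi (x, y)) (phi (x', y')) = pd P (x, y) (x', y').
  by move=> Yy Yy'; case: PphiS => + _; apply.
pose i (h : G) : Hm := [ffun=> j h].
exists Hm, rho', (phi @` S), i; split=> //.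
- by move=> g h; apply/ffunP => k; rewrite !ffunE jM.
- split; first exact: finite_image.
    by move=> y Fy; exists (1%g, y); [split=> //; exact: FY1|apply: phi1; exact: FY1].
  by move=> g _ [[x y] [_ Yy] <-]; rewrite rphi//; exists ((g * x)%g, y).
- split=> [h y /FY1 Yy|].
    rewrite r1// -[RHS]phi1; last exact: Y1rho.
    apply: mdist_positivity; rewrite dphi//; last exact: Y1rho.
    rewrite /P [LHS]/=; under eq_kf do rewrite co1 /co ffunE /= Qj.
    by rewrite kf_cst// lexx ltW.
  exists ([ffun=> t] : Hm) => y Fy.
  rewrite r1; last exact: FY1.
  rewrite -[X in mdist _ X]phi1; last exact: gY1.
  rewrite dphi; [|exact: FY1|exact: gY1].
  apply: le_trans (kf_le _ _ finset.set0) _; rewrite kfv_set0.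
  by apply: bigmax_le => [|k _]; [exact: ltW|rewrite co1 /co ffunE].
- move=> B eB.
  have t0 : 0 < e * m%:R / c by rewrite divr_gt0// mulr_gt0// ltr0n.
  have H0 : (0 < #|H|)%N by apply/card_gt0P; exists 1%g.
  apply: le_trans (hamming_concentration H0 e0 t0 mP eB).
  rewrite ler_nat; apply/subset_leq_card/fintype.subsetP => g; rewrite !inE.
  apply: contra => /existsP[b /andP[bB gb]]; apply/existsP; exists b.
  rewrite bB/=; apply/asboolP => x Fx; have Yx := FY1 x Fx.
  rewrite r1// -{2}(phi1 x Yx) dphi//.
  (* On the coordinates that are kept, [g * b^-1] is trivial and the distance is 0. *)
  apply: le_lt_trans (kf_le _ _ [set k | g k != b k]%SET) _.
  rewrite /kfv; set M := \big[_/_]_(_ | _) _.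
  have M0 : M <= 0.
    apply: bigmax_le => // k; rewrite inE negbK => /eqP gbk.
    by rewrite co1 /co /= !ffunE gbk mulgV pdxx.
  suff : c * (#|[set k | g k != b k]%SET|%:R / #|'I_m|%:R) < e by lra.
  move: gb; rewrite ltr_pdivlMr//.
  have -> : hamming g b = #|[set k | g k != b k]%SET|.
    rewrite /hamming -sum1_card [RHS]big_mkcond; apply: eq_bigr => k _.
    by rewrite inE; case: eqP.
  by rewrite card_ord mulrA ltr_pdivrMr ?ltr0n// mulrC.
Qed.

End step.

(** * Topology and counting measures *)

Section topology.
Variables (R : realType) (L : signature R) (U : prestructure L).

(** The sets with this property form a filter that converges pointwise to [f], hence contains every
    neighborhood of [f]. *)
Lemma iso_nbhs_basis (f : Iso U) (A : set (Iso U)) : nbhs f A ->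
  exists (F : seq U) (e : R), 0 < e /\
    forall g : Iso U, (forall x, x \in F -> mdist (g x) (f x) < e) -> A g.
Proof.
pose S : set_system (Iso U) := [set A | exists (F : seq U) (e : R), 0 < e /\
    forall g : Iso U, (forall x, x \in F -> mdist (g x) (f x) < e) -> A g].
have FS : Filter S.
  split.
  - by exists [::], 1.
  - move=> A1 A2 [F1 [e1 [e10 H1]]] [F2 [e2 [e20 H2]]].
    exists (F1 ++ F2), (Num.min e1 e2); rewrite lt_min e10 e20; split=> // g Hg.
    split; [apply: H1|apply: H2] => x xF; have := Hg x;
      by rewrite mem_cat xF ?orbT lt_min => /(_ isT)/andP[].
  - by move=> A1 A2 A12 [F [e [e0 H]]]; exists F, e; split=> // g /H; exact: A12.
suff : S --> f by apply.
apply/iso_cvgP => x B /nbhs_ballP[e /= e0 eB].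
exists [:: x], e; split=> // g Hg; apply: eB.
by rewrite ballEmdist /= metric_sym Hg ?mem_head.
Qed.

End topology.

Section counting.
Variables (R : realType) (T : topGroupType) (G : finGroupType) (Phi : G -> T).
Hypothesis PhiM : forall g h, Phi (g * h)%g = (Phi g * Phi h)%g.

Let Phi1 : Phi 1%g = 1%g.
Proof. by apply: (mulgI (Phi 1%g)); rewrite -PhiM !mulg1. Qed.

Lemma finite_subgroup_range : finite_subgroup (range Phi).
Proof.
split; first by apply: finite_image; exact: finite_finset.
split; first by rewrite inE; exists 1%g.
move=> x y; rewrite !inE => -[g _ <-] [h _ <-]; exists (g * h^-1)%g => //.
rewrite PhiM; congr (_ * _)%g; apply: (mulgI (Phi h)).
by rewrite -PhiM !mulgV.
Qed.

(** The fibres of [Phi] are the cosets of its kernel. *)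
Lemma card_fiber (X : {fset T}) : (forall x, x \in X -> range Phi x) ->
  #|[pred g | Phi g \in X]| = (#|` X| * #|[pred g | Phi g == 1%g]|)%N.
Proof.
move=> XPhi.
have -> : #|[pred g | Phi g \in X]| =
    (\sum_(x <- X) \sum_g (Phi g == x : nat))%N.
  rewrite exchange_big /= -sum1_card big_mkcond /=; apply: eq_bigr => g _.
  rewrite inE.
  have -> : (if Phi g \in X then 1 else 0)%N = (Phi g \in X : nat) by case: ifP.
  rewrite -(count_uniq_mem (Phi g) (fset_uniq X)) -sum1_count big_mkcond /=.
  by apply: eq_bigr => x _; rewrite eq_sym; case: eqP.
rewrite big_seq (eq_bigr (fun=> #|[pred g | Phi g == 1%g]|)).
  rewrite -big_seq big_const_seq count_predT iter_addn_0 mulnC.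
  by [].
move=> x /XPhi[h _ <-]; rewrite -sum1_card [RHS]big_mkcond /=.
rewrite (reindex_inj (mulgI h)) /=; apply: eq_bigr => g _.
by rewrite PhiM -[X in _ == X]mulg1 (inj_eq (mulgI _)) inE; case: eqP.
Qed.

(** As all fibres have the same size, the uniform probability on the range is the image of that on
    [G], even if [Phi] is not injective. *)
Lemma unif_prob_range (A : set T) :
  unif_prob R (range Phi) A = #|[pred g | `[<A (Phi g)>]]|%:R / #|G|%:R.
Proof.
have fr : finite_set (range Phi) by apply: finite_image; exact: finite_finset.
have k0 : (0 < #|[pred g | Phi g == 1%g]|)%N.
  by apply/card_gt0P; exists 1%g; rewrite inE Phi1.
have -> : #|[pred g | `[<A (Phi g)>]]| =
    #|[pred g | Phi g \in fset_set (A `&` range Phi)]|.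
  apply: eq_card => g; rewrite !inE in_fset_set; last exact: finite_setIr.
  apply/asboolP/idP; rewrite inE; last by case.
  by move=> AP; split=> //; exists g.
have -> : #|G| = #|[pred g | Phi g \in fset_set (range Phi)]|.
  by apply: eq_card => g; rewrite !inE in_fset_set//; apply/esym/mem_set; exists g.
rewrite /unif_prob !card_fiber.
- by rewrite !natrM invfM mulrACA divff ?mulr1// pnatr_eq0 -lt0n.
- by move=> x; rewrite in_fset_set// inE.
- by move=> x; rewrite in_fset_set ?inE => [[]|]//; exact: finite_setIr.
Qed.

End counting.

Lemma limn_einf_gt0 (R : realType) (u : nat -> R) :
  (0 < limn_einf (fun i => (u i)%:E))%E ->
  exists2 c : R, 0 < c & exists N, forall n, (N <= n)%N -> c <= u n.
Proof.
have lE := cvg_lim (@ereal_hausdorff R) (cvg_einfs_sup (R := R) (u := fun i => (u i)%:E)).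
rewrite limn_einf_lim lE.
move=> /ereal_sup_gt[_ [N _ <-]] u0.
have uN n : (N <= n)%N -> (einfs (fun i => (u i)%:E) N <= (u n)%:E)%E.
  by move=> Nn; apply: ereal_inf_lbound; exists n.
case E : (einfs (fun i => (u i)%:E) N) u0 uN => [c||] // c0 uN.
  by exists c => //; exists N => n /uN.
by have := uN N (leqnn N).
Qed.

(** * The chain of finite groups *)

Section chain.
Variables (R : realType) (L : signature R) (U : structure L).
Hypothesis (Llin : forall (s : rel_symb L) (i : 'I_(arity s)),
  linear_below1 (rel_mod i)).
Hypotheses (hU : urysohn U) (hsep : separable U).

(** A refinement reproduces the action of a stage only on [stage_set]; elsewhere the automorphisms
    may change, so the final subgroups are obtained as limits. *)
Record stage := Stage {
  stage_group : finGroupType;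
  stage_hom : stage_group -> Iso U;
  stage_set : set U;
  stage_homM : forall g h, stage_hom (g * h)%g = (stage_hom g * stage_hom h)%g;
  stage_fin : finite_set stage_set;
  stage_inv : forall g y, stage_set y -> stage_set (stage_hom g y)
}.

Definition refines (gamma : Iso U) (F : set U) (e : R) (s s' : stage)
    (i : stage_group s -> stage_group s') :=
  [/\ forall g h, i (g * h)%g = (i g * i h)%g,
      stage_set s `<=` stage_set s' /\ F `<=` stage_set s',
      forall h y, stage_set s y -> stage_hom (i h) y = stage_hom h y,
      exists t : stage_group s', forall y, F y -> mdist (stage_hom t y) (gamma y) <= e
    & forall B : {pred stage_group s'}, e * #|stage_group s'|%:R <= #|B|%:R ->
        #|[pred g : stage_group s' | ~~ [exists b, (b \in B) &&
            `[<forall x, stage_set s x -> mdist (stage_hom (g * b^-1)%g x) x < e>]]]|%:R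
          <= e * #|stage_group s'|%:R].

Lemma refines_ex gamma (F : set U) (e : R) (s : stage) :
  finite_set F -> 0 < e ->
  exists s' (i : stage_group s -> stage_group s'), refines gamma F e i.
Proof.
move=> fF e0.
have fsF : finite_set (stage_set s `|` F).
  by rewrite finite_setU; split=> //; exact: stage_fin.
have [G' [rho' [Y [i [rhoM iM [fY FY Yinv] [iE [t tE]] conc]]]]] :=
  levy_step Llin hU hsep gamma (@stage_homM s) fsF e0.
exists (Stage rhoM fY Yinv), i; split=> //=.
- by split=> y yF; apply: FY; [left|right].
- by move=> h y sy; apply: iE; left.
- by exists t => y Fy; apply: tE; right.
- move=> B /conc; apply: le_trans; rewrite ler_nat.
  apply/subset_leq_card/fintype.subsetP => g; rewrite !inE; apply: contra.
  move=> /existsP[b /andP[bB /asboolP H]]; apply/existsP; exists b.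
  by rewrite bB; apply/asboolP => x sx; apply: H; left.
Qed.

Lemma stage_inhabited : inhabited stage.
Proof.
pose rho (g : {perm 'I_0}) : Iso U := 1%g.
have rhoM g h : rho (g * h)%g = (rho g * rho h)%g by rewrite /rho mulg1.
have iY (g : {perm 'I_0}) (y : U) : set0 y -> set0 (rho g y) by [].
by exists; exact: (Stage rhoM (@finite_set0 U) iY).
Qed.

Variables (gamma : nat -> Iso U) (F : nat -> set U) (e : nat -> R).
Variables (st : nat -> stage)
  (lift : forall n, stage_group (st n) -> stage_group (st n.+1)).
Hypothesis st_refines : forall n, refines (gamma n) (F n) (e n) (@lift n).
Hypothesis st_dense : dense (\bigcup_n stage_set (st n)).

(* The values before stage [n] are irrelevant. *)
Fixpoint thread n (g : stage_group (st n)) m : stage_group (st m) :=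
  match pselect (n = m) with
  | left nm => eq_rect n (fun k => stage_group (st k)) g m nm
  | right _ => if m is m'.+1 then lift (thread g m') else 1%g
  end.

Lemma thread_id n (g : stage_group (st n)) : thread g n = g.
Proof.
by case: n g => [|n] g /=; (case: pselect => [nn|//]); rewrite (Prop_irrelevance nn erefl).
Qed.

Lemma threadS n (g : stage_group (st n)) m :
  (n <= m)%N -> thread g m.+1 = lift (thread g m).
Proof.
move=> nm; rewrite [LHS]/=; case: pselect => // E; exfalso.
by have := nm; rewrite {1}E ltnn.
Qed.

Lemma threadM n (g h : stage_group (st n)) m : (n <= m)%N ->
  thread (g * h)%g m = (thread g m * thread h m)%g.
Proof.
move=> /subnK <-; elim: (m - n)%N => [|k IH]; first by rewrite !thread_id.
rewrite !threadS ?leq_addl// IH; by case: (st_refines (k + n)%N).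
Qed.

Lemma thread_lift n (g : stage_group (st n)) m : (n < m)%N ->
  thread (lift g) m = thread g m.
Proof.
move=> /subnK <-; elim: (m - n.+1)%N => [|k IH].
  by rewrite thread_id threadS// thread_id.
by rewrite [LHS]threadS ?leq_addl// IH [RHS]threadS// ltnW ?leq_addl.
Qed.

Lemma stage_mono m n : (m <= n)%N -> stage_set (st m) `<=` stage_set (st n).
Proof.
move=> /subnK <-; elim: (n - m)%N => [//|k IH] x /IH.
by case: (st_refines (k + m)%N) => _ [+ _] _ _ _; exact.
Qed.

(** From stage [m] on, the action of the image of [g] on [stage_set (st m)] no longer changes, and
    these sets exhaust a dense set. *)
Lemma limit_hom n : exists Phi : stage_group (st n) -> Iso U,
  (forall g h, Phi (g * h)%g = (Phi g * Phi h)%g) /\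
  (forall m g y, (n <= m)%N -> stage_set (st m) y ->
     Phi g y = stage_hom (thread g m) y).
Proof.
have [||||Phi [PhiM PhiE]] := @acts_limit R L (stage_group (st n)) U
  (fun k => stage_set (st (k + n)))
  (fun k g y => stage_hom (thread g (k + n)) y).
- move=> k; have homM (g h : stage_group (st n)) : stage_hom (thread (g * h)%g (k + n)) =
      (stage_hom (thread g (k + n)) * stage_hom (thread h (k + n)))%g.
    by rewrite threadM ?leq_addl// stage_homM.
  split.
  + by move=> g y; exact: stage_inv.
  + by move=> y _; rewrite (hom1 homM).
  + by move=> g h y _; rewrite homM.
  + move=> g; have [_ [gd gr]] := iso_automorphism (stage_hom (thread g (k + n))).
    by split=> [x y _ _|s a _]; [exact: gd|exact: gr].
- by move=> k; apply: stage_mono; rewrite addSn.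
- move=> k g y sy; rewrite [thread g (k.+1 + n)]threadS ?leq_addl//.
  by case: (st_refines (k + n)%N) => _ _ + _ _; exact.
- move=> O O0 Oo; have [x [Ox [m _ sx]]] := st_dense O0 Oo.
  by exists x; split=> //; exists m => //; apply: stage_mono sx; exact: leq_addr.
exists Phi; split=> // m g y nm.
by have := PhiE (m - n)%N g y; rewrite subnK.
Qed.

End chain.

(** * Choice of the stages and conclusion *)

Theorem corollary8p15 (R : realType) (L : signature R) (U : structure L)
    (hL : lipschitz_sig L) (hsep : separable U) (hU : urysohn U) :
  strong_levy R (Iso U).
Proof.
have Llin (s : rel_symb L) (i : 'I_(arity s)) : linear_below1 (rel_mod i).
  case: hL => -[[_ lin2] _] lin1; have := arity_gt0 s.
  case E : (arity s) => [|[|k]] // _; first exact: lin1.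
  by apply: lin2; rewrite E.
have [p dp] := separable_seq hsep (urysohn_inh hU).
(* A task is a list of pairs [(a, b)] and a tolerance [1 / k.+1]: it asks for an automorphism that
   sends each [p a] near [p b]. [eps n] is below this tolerance and tends to 0. *)
pose task n : seq (nat * nat) * nat :=
  odflt ([::], 0%N) (@choice.unpickle (seq (nat * nat) * nat)%type n).
pose eps n : R := (n.+1%:R * (task n).2.+1%:R)^-1.
pose good n (g : Iso U) := forall ab, ab \in (task n).1 ->
  mdist (g (p ab.1)) (p ab.2) < (task n).2.+1%:R^-1.
have eps0 n : 0 < eps n by rewrite invr_gt0 mulr_gt0 ?ltr0n.
have eps1 n : eps n <= n.+1%:R^-1.
  by rewrite lef_pV2 ?posrE ?mulr_gt0 ?ltr0n// ler_peMr// ler1n.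
have eps2 n : eps n <= (task n).2.+1%:R^-1.
  by rewrite lef_pV2 ?posrE ?mulr_gt0 ?ltr0n// ler_peMl// ler1n.
have /choice[gamma gammaE] : forall n, exists g : Iso U,
    (exists g', good n g') -> good n g.
  move=> n; have [[g gn]|ng] := pselect (exists g', good n g'); first by exists g.
  by exists 1%g => /ng.
(* The points [p n] make the union of the stages dense; the others are those on which the task is to
   be met. *)
pose F n : set U := [set p n] `|` [set` [seq p ab.1 | ab <- (task n).1]].
have fF n : finite_set (F n) by rewrite finite_setU; split=> //; exact: finite_seq.
have /choice[nxt nxtE] : forall ns : nat * stage U, exists s',
    exists i : stage_group ns.2 -> stage_group s',
      refines (gamma ns.1) (F ns.1) (eps ns.1) i.
  by move=> [n s]; exact: refines_ex.
have [s0] := stage_inhabited U.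
have [st [lift liftP]] : exists (st : nat -> stage U)
    (lift : forall n, stage_group (st n) -> stage_group (st n.+1)),
    forall n, refines (gamma n) (F n) (eps n) (lift n).
  pose st := fix st n : stage U := if n is n'.+1 then nxt (n', st n') else s0.
  exists st, (fun n => sval (cid (nxtE (n, st n)))) => n.
  exact: svalP (cid (nxtE (n, st n))).
have st_dense : dense (\bigcup_n stage_set (st n)).
  move=> O O0 Oo; have [x [Ox [n _ pn]]] := dp O O0 Oo.
  exists x; split=> //; exists n.+1 => //.
  by case: (liftP n) => _ [_ FS] _ _ _; apply: FS; left; rewrite /= pn.
have PhiX n := cid (limit_hom liftP st_dense n).
pose Phi n : stage_group (st n) -> Iso U := sval (PhiX n).
have PhiM n g h : Phi n (g * h)%g = (Phi n g * Phi n h)%g.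
  exact: (svalP (PhiX n)).1.
have PhiE n m g y : (n <= m)%N -> stage_set (st m) y ->
    Phi n g y = stage_hom (thread lift g m) y.
  exact: (svalP (PhiX n)).2.
clearbody Phi; clear PhiX.
have PhiS n g : Phi n.+1 (lift n g) = Phi n g.
  apply: (iso_dense_eq st_dense) => x [m _ sx].
  pose k := maxn m n.+1.
  have sk : stage_set (st k) x by apply: (stage_mono liftP) sx; exact: leq_maxl.
  have nk : (n < k)%N by exact: leq_maxr.
  by rewrite (PhiE n.+1 k)// (PhiE n k)// ?thread_lift// ltnW.
have Phi_id n g y : stage_set (st n) y -> Phi n g y = stage_hom g y.
  by move=> sy; rewrite (PhiE _ n)// thread_id.
(* The shift by one matches [liftP n], which gives approximation and concentration in the group of
   stage [n.+1] at precision [eps n]. *)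
exists (fun n => range (Phi n.+1)); split.
- by move=> n; exact: finite_subgroup_range.
- by move=> n _ [g _ <-]; exists (lift n.+1 g).
- move=> O [f Of] Oo.
  have [E [e [e0 HE]]] := iso_nbhs_basis (open_nbhs_nbhs (conj Oo Of)).
  (* With tolerance [d], the final estimate is [d / 2 + d + d + d / 2 = 3 * d]. *)
  pose k := Num.trunc (3 / e).
  have ke : 3 / k.+1%:R < e.
    by rewrite ltr_pdivrMr ?ltr0n// mulrC -ltr_pdivrMr// truncnS_gt.
  set d : R := k.+1%:R^-1 in ke.
  have d20 : 0 < d / 2 by rewrite divr_gt0 // invr_gt0 ltr0n.
  have pnear (x : U) : {n | mdist x (p n) < d / 2}.
    by apply: cid; have [_ [n _ <-]] := dense_dist dp x d20; exists n.
  pose a x := sval (pnear x).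
  have aP x : mdist x (p (a x)) < d / 2 by exact: svalP (pnear x).
  pose l := [seq (a x, a (f x)) | x <- E].
  pose n := choice.pickle (l, k).
  have tn : task n = (l, k) by rewrite /task /n choice.pickleK.
  have isod (g : Iso U) x y : mdist (g x) (g y) = mdist x y.
    by have [_ [gd _]] := iso_automorphism g.
  (* The automorphism [f] itself meets the task, so [gamma n] does too. *)
  have gn : good n (gamma n).
    apply: gammaE; exists f => ab; rewrite tn => /mapP[x xE ->] /=.
    apply: le_lt_trans (metric_triangle _ (f x) _) _.
    by rewrite isod (metric_sym _ x) [ltRHS]splitr ltrD.
  have [_ [_ FS] _ [t tE] _] := liftP n.
  exists (Phi n.+1 t); split; last by exists n => //; exists t.
  apply: HE => x xE.
  have Fx : F n (p (a x)).
    by right; apply/mapP; exists (a x, a (f x)); rewrite // tn; apply/mapP; exists x.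
  have H1 : mdist (Phi n.+1 t (p (a x))) (gamma n (p (a x))) <= d.
    rewrite Phi_id; last exact: FS.
    by apply: le_trans (tE _ Fx) _; apply: le_trans (eps2 n) _; rewrite tn.
  have H2 : mdist (gamma n (p (a x))) (p (a (f x))) < d.
    have := gn (a x, a (f x)); rewrite tn; apply; apply/mapP; by exists x.
  have H3 := aP x; have H4 := aP (f x).
  have := metric_triangle (Phi n.+1 t x) (Phi n.+1 t (p (a x))) (f x).
  have := metric_triangle (Phi n.+1 t (p (a x))) (gamma n (p (a x))) (f x).
  have := metric_triangle (gamma n (p (a x))) (p (a (f x))) (f x).
  rewrite isod (metric_sym (p (a (f x)))).
  by move: ke; rewrite -/d; lra.
move=> V A Vo V1 AK liminf.
have [N VN] : exists N, forall n, (N <= n)%N -> forall v : Iso U,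
    (forall x, stage_set (st n) x -> mdist (v x) x < eps n) -> V v.
  have [E [e [e0 HE]]] := iso_nbhs_basis (open_nbhs_nbhs (conj Vo V1)).
  have e30 : 0 < e / 3 by rewrite divr_gt0.
  have HN x : exists N, forall n, (N <= n)%N -> forall v : Iso U,
      (forall x, stage_set (st n) x -> mdist (v x) x < eps n) -> mdist (v x) x < e.
    have [z [m _ sz] xz] := dense_dist st_dense x e30.
    (* Stage [m] contains [z], and the second bound gives [eps n < e / 3]. *)
    exists (maxn m (Num.trunc (e / 3)^-1)) => n; rewrite geq_max => /andP[mn en] v vP.
    have en' : eps n < e / 3.
      apply: le_lt_trans (eps1 n) _; rewrite -[ltRHS]invrK ltf_pV2 ?posrE ?invr_gt0//.
      by apply: lt_le_trans (truncnS_gt _) _; rewrite ler_nat ltnS.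
    have vz := vP z (stage_mono liftP mn sz).
    have [_ [vd _]] := iso_automorphism v.
    have := metric_triangle (v x) (v z) x; have := metric_triangle (v z) z x.
    rewrite vd (metric_sym z x); lra.
  have [N HN'] : exists N, forall n, (N <= n)%N -> forall v : Iso U,
      (forall x, stage_set (st n) x -> mdist (v x) x < eps n) ->
      forall x, x \in E -> mdist (v x) x < e.
    elim: E {HE} => [|x E [N IH]]; first by exists 0%N.
    have [N' HN'] := HN x; exists (maxn N N') => n; rewrite geq_max => /andP[Nn N'n] v vP y.
    rewrite inE => /predU1P[->|yE]; first exact: (HN' n).
    exact: (IH n).
  by exists N => n Nn v vP; apply: HE => x xE; exact: (HN' n).
have [c c0 [N' cN']] := limn_einf_gt0 liminf.
have unif n : (N <= n)%N -> (N' <= n)%N -> eps n <= c ->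
    1 - eps n <= unif_prob R (range (Phi n.+1)) [set (v * a)%g | v in V & a in A n] <= 1.
  move=> Nn N'n enc; set G := stage_group (st n.+1).
  have G0 : 0 < #|G|%:R :> R.
    by rewrite ltr0n; apply/card_gt0P; exists 1%g.
  rewrite unif_prob_range//; apply/andP; split; last first.
    by rewrite ler_pdivrMr// mul1r ler_nat max_card.
  pose B : {pred G} := [pred g | `[<A n (Phi n.+1 g)>]].
  have eB : eps n * #|G|%:R <= #|B|%:R.
    rewrite -ler_pdivlMr// -unif_prob_range//; apply: le_trans enc _.
    exact: cN'.
  have [_ [stS _] _ _ /(_ B eB) conc] := liftP n.
  rewrite ler_pdivlMr// mulrBl mul1r lerBlDl.
  set Q := [pred g | _] in conc; set P := [pred g | _].
  have : (#|G| <= #|Q| + #|P|)%N.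
    rewrite -(cardC Q) leq_add2l; apply/subset_leq_card/fintype.subsetP => g.
    rewrite !inE negbK => /existsP[b /andP[/asboolP Ab /asboolP gb]].
    (* The factorization [g = (g * b^-1) * b] exhibits [Phi n.+1 g] in the product of [V] and [A n]:
       the first factor moves the points of stage [n] by less than [eps n]. *)
    exists (Phi n.+1 (g * b^-1)%g).
      apply: (VN n Nn) => x sx; rewrite Phi_id; first exact: gb.
      exact: stS.
    by exists (Phi n.+1 b) => //; rewrite -PhiM mulgKV.
  rewrite -(ler_nat R) natrD => le; apply: le_trans le _.
  by rewrite lerD2r.
apply/cvgrPdist_le => e e0.
near=> n.
have en1 : eps n <= e.
  apply: le_trans (eps1 n) _; rewrite -[leRHS]invrK lef_pV2 ?posrE ?invr_gt0 ?ltr0n//.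
  apply: ltW; apply: lt_le_trans (truncnS_gt _) _; rewrite ler_nat ltnS.
  by near: n; exact: nbhs_infty_ge.
have /andP[u1 u2] : 1 - eps n <= unif_prob R (range (Phi n.+1))
    [set (v * a)%g | v in V & a in A n] <= 1.
  apply: unif; [by near: n; exact: nbhs_infty_ge|by near: n; exact: nbhs_infty_ge|].
  apply: le_trans (eps1 n) _; rewrite -[leRHS]invrK lef_pV2 ?posrE ?invr_gt0 ?ltr0n//.
  apply: ltW; apply: lt_le_trans (truncnS_gt _) _; rewrite ler_nat ltnS.
  by near: n; exact: nbhs_infty_ge.
by rewrite ger0_norm ?subr_ge0//; lra.
Unshelve. all: by end_near. Qed.
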